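(* Let $n\ge1$ be an integer and let $M_c$, $c\in(0,\infty)$, be the non-totally geodesic rotational minimal hypersurface (catenoid) in $\mathbb{H}^{2n+1}$ with parameter $c$. The renormalized area of $M_c$ is given by the hyperelliptic integral $$\mathcal{A}_R(M_c)=\frac{2\pi^n}{(n-1)!\,c^{2n-1}}\int_0^\alpha \frac{q_n(u)}{\sqrt{u\left(-u^{2n}+c^2u+(2n-1)^2\right)}}\,du,$$ where $\alpha$ is the only positive solution of $-u^{2n}+c^2u+(2n-1)^2=0$, and $q_n$ is the polynomial of degree $n(2n-1)$ given by $$q_n(u)=\sum_{i=1}^n(-1)^i\binom{n}{i}(2n-1)^{2(n-i)}(2i-1)\,u^{n(2i-1)}.$$
   Context: Hyperbolic space is the hyperboloid $\mathbb{H}^{2n+1}=\{(x_1,\dots,x_{2n+1},z)\in\mathbb{R}^{2n+2}: \sum_{i=1}^{2n+1}x_i^2-z^2=-1,\ z>0\}$ with the metric induced by $\sum_i dx_i^2-dz^2$. Catenoids. A (spherical) rotational hypersurface is a hypersurface invariant under $O(2n)$ acting on $(x_1,\dots,x_{2n})$; non-totally geodesic rotational minimal hypersurfaces are called catenoids and form a one-parameter family $\{M_c\}_{c>0}$ described as follows. Let $Q_{n,c}(u)=-u^{2n}+c^2u+(2n-1)^2$, with unique positive root $\alpha$, and let $u:\mathbb{R}\to(0,\alpha]$ be the non-constant smooth solution of $(u')^2=\frac{4u^2}{(2n-1)^2}Q_{n,c}(u)$ with $u(0)=\alpha$. Put $v(s)=-c\int_0^s\frac{u^{n+1/2}}{c^2u+(2n-1)^2}\,d\sigma$.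 Then $$M_c=\left\{\frac{1}{c\sqrt{u(s)}}\left((2n-1)\,\omega,\ \sqrt{c^2u(s)+(2n-1)^2}\,\sinh v(s),\ \sqrt{c^2u(s)+(2n-1)^2}\,\cosh v(s)\right): s\in\mathbb{R},\ \omega\in\mathbb{S}^{2n-1}\subset\mathbb{R}^{2n}\right\},$$ where $s$ is the arc length parameter of the generating curve and $\kappa=u^n$ is its curvature. Renormalized area. For a hypersurface $M\subset\mathbb{H}^{2n+1}$ the renormalized area $\mathcal{A}_R(M)$ is the constant term in the expansion, in powers of $\epsilon>0$ as $\epsilon\to0^+$, of the area of the truncated hypersurface $M_\epsilon=M\cap\{z\le 1/\epsilon\}$. *)

(* Defs.v *)
From HB Require Import structures.
From mathcomp Require Import all_boot all_order all_algebra.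
From mathcomp Require Import all_classical all_reals all_analysis.
Import Order.TTheory GRing.Theory Num.Theory.
Import numFieldNormedType.Exports.

Set Implicit Arguments.
Unset Strict Implicit.
Unset Printing Implicit Defensive.

Local Open Scope classical_set_scope.
Local Open Scope ring_scope.

(* Lebesgue measure on R^m, with m-tuples of reals as points: the m-fold
   product of the Lebesgue measure of the line, obtained by recursion on m
   through the bijection R x R^m -> R^(m+1). *)
Section LebesgueTuple.
Context {R : realType}.
Local Notation Rt m := (m.-tuple (measurableTypeR R)).

Definition cons_pair (m : nat) (p : measurableTypeR R * Rt m) : Rt m.+1 :=
  [the m.+1.-tuple (measurableTypeR R) of p.1 :: p.2].

Definition uncons_pair (m : nat) (t : Rt m.+1) : measurableTypeR R * Rt m :=
  (thead t, [tuple of behead t]).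

Lemma cons_pairK (m : nat) : cancel (@cons_pair m) (@uncons_pair m).
Proof.
move=> [x t]; rewrite /uncons_pair /cons_pair /=; congr pair.
by apply/val_inj.
Qed.

Lemma uncons_pairK (m : nat) : cancel (@uncons_pair m) (@cons_pair m).
Proof. by move=> t; rewrite [RHS]tuple_eta; apply/val_inj. Qed.

Lemma measurable_cons_pair (m : nat) : measurable_fun setT (@cons_pair m).
Proof.
by apply: measurable_cons; [exact: measurable_fst | exact: measurable_snd].
Qed.

Lemma measurable_uncons_pair (m : nat) : measurable_fun setT (@uncons_pair m).
Proof.
apply: measurable_fun_pair.
  exact: (measurable_tnth (T := measurableTypeR R) ord0).
exact: measurable_behead.
Qed.

Section LebesgueCons.
Variables (m : nat) (mu : {sigma_finite_measure set (Rt m) -> \bar R}).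

Definition lebesgue_cons : set (Rt m.+1) -> \bar R :=
  pushforward (@lebesgue_measure R \x mu)%E (@cons_pair m).

Let preimage_measurable (A : set (Rt m.+1)) :
  measurable A -> measurable (@cons_pair m @^-1` A).
Proof.
by move=> mA; rewrite -[X in measurable X]setTI; exact: measurable_cons_pair.
Qed.

Let lebesgue_cons0 : lebesgue_cons set0 = 0%E.
Proof. by rewrite /lebesgue_cons /pushforward preimage_set0 measure0. Qed.

Let lebesgue_cons_ge0 A : (0 <= lebesgue_cons A)%E.
Proof. by rewrite /lebesgue_cons /pushforward; exact: measure_ge0. Qed.

Let lebesgue_cons_sigma_additive : semi_sigma_additive lebesgue_cons.
Proof.
move=> F mF tF mUF; rewrite /lebesgue_cons /pushforward preimage_bigcup.
apply: measure_semi_sigma_additive.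
- by move=> k; exact: preimage_measurable.
- apply/trivIsetP => /= i j _ _ ij; rewrite -preimage_setI.
  by move/trivIsetP : tF => /(_ _ _ _ _ ij) ->//; rewrite preimage_set0.
- by rewrite -preimage_bigcup; exact: preimage_measurable.
Qed.

HB.instance Definition _ := isMeasure.Build _ _ _ lebesgue_cons
  lebesgue_cons0 lebesgue_cons_ge0 lebesgue_cons_sigma_additive.

Let lebesgue_cons_sigma_finite : sigma_finite setT lebesgue_cons.
Proof.
have /sigma_finiteP[F [TF ndF Foo]] := sigma_finiteT (@lebesgue_measure R).
have /sigma_finiteP[G [TG ndG Goo]] := sigma_finiteT mu.
exists (fun k => @uncons_pair m @^-1` (F k `*` G k)).
  rewrite -preimage_bigcup; apply/seteqP; split=> // t _ /=.
  have [i _ Fi] : (\bigcup_i F i) (thead t) by rewrite -TF.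
  have [j _ Gj] : (\bigcup_i G i) [tuple of behead t] by rewrite -TG.
  exists (maxn i j) => //; split=> /=.
    by move: Fi; exact/subsetPset/ndF/leq_maxl.
  by move: Gj; exact/subsetPset/ndG/leq_maxr.
move=> k; have [mF Fk] := Foo k; have [mG Gk] := Goo k; split.
  rewrite -[X in measurable X]setTI.
  by apply: measurable_uncons_pair => //; exact: measurableX.
rewrite /lebesgue_cons /pushforward -comp_preimage.
rewrite (_ : _ \o _ = id); last by apply/funext => p /=; rewrite cons_pairK.
by rewrite preimage_id product_measure1E// lte_mul_pinfty// ge0_fin_numE.
Qed.

HB.instance Definition _ := Measure_isSigmaFinite.Build _ _ _ lebesgue_cons
  lebesgue_cons_sigma_finite.

End LebesgueCons.

Fixpoint lebesgue_tuple (m : nat) :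
    {sigma_finite_measure set (Rt m) -> \bar R} :=
  if m is k.+1 then lebesgue_cons (lebesgue_tuple k)
  else \d_([tuple] : Rt 0).

End LebesgueTuple.

Section Hyperboloid.
Context {R : realType}.

(* A point of R^(N+1) is a block row (x, z) with x in R^N and z in R. *)
Definition zcoord (N : nat) (X : 'rV[R]_(N + 1)) : R := rsubmx X 0 0.

Definition minkowski (N : nat) (X Y : 'rV[R]_(N + 1)) : R :=
  \sum_(i < N) lsubmx X 0 i * lsubmx Y 0 i - zcoord X * zcoord Y.

Definition hyperbolic_space (N : nat) : set 'rV[R]_(N + 1) :=
  [set X | minkowski X X = -1 /\ 0 < zcoord X].

(* Row i of the Jacobian matrix jacobian phi p is the i-th partial derivative of phi
   at p, so this is the matrix of the first fundamental form. *)
Definition first_form (m N : nat) (phi : 'rV[R]_m -> 'rV[R]_(N + 1))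
    (p : 'rV[R]_m) : 'M[R]_m :=
  \matrix_(i, j) minkowski (row i (jacobian phi p)) (row j (jacobian phi p)).

Definition regular_patch (m N : nat) (U : set 'rV[R]_m)
    (phi : 'rV[R]_m -> 'rV[R]_(N + 1)) : Prop :=
  [/\ open U,
      (forall p, U p -> differentiable phi p) /\
      (forall p, U p -> {for p, continuous (jacobian phi)}),
      forall p, U p -> row_free (jacobian phi p),
      set_inj U phi &
      forall p, U p -> hyperbolic_space (phi p)].

Definition row_of_tuple (m : nat) (t : m.-tuple (measurableTypeR R)) :
  'rV[R]_m := \row_i tnth t i.

(* The m-dimensional Riemannian volume of a subset M of hyperbolic space: M is
   cut into countably many disjoint pieces phi_k(E_k), with phi_k a regular
   patch and E_k a measurable set of parameters, and the integrals of the
   volume densities sqrt(det g_ij) are added up. By the change of variables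
   formula the value does not depend on the pieces. *)
Definition has_area (m N : nat) (M : set 'rV[R]_(N + 1)) (a : \bar R) : Prop :=
  exists (U : nat -> set 'rV[R]_m) (phi : nat -> 'rV[R]_m -> 'rV[R]_(N + 1))
         (E : nat -> set (m.-tuple (measurableTypeR R))),
  [/\ forall k, regular_patch (U k) (phi k),
      forall k, measurable (E k) /\ (forall t, E k t -> U k (row_of_tuple t)),
      M = \bigcup_k ((phi k \o @row_of_tuple m) @` E k),
      trivIset setT (fun k => (phi k \o @row_of_tuple m) @` E k) &
      a = (\sum_(0 <= k <oo) \int[lebesgue_tuple m]_(t in E k)
            (Num.sqrt (\det (first_form (phi k) (row_of_tuple t))))%:E)%E].

(* l is the constant term of an expansion of A in powers of e as e -> 0+. The
   finitely many negative powers are written out, the positive ones tend to 0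
   and do not affect the constant term. *)
Definition constant_term (A : R -> R) (l : R) : Prop :=
  exists (K : nat) (a : nat -> R),
    (A e - \sum_(1 <= k < K.+1) a k * e ^- k) @[e --> 0^'+] --> l.

Definition truncation (N : nat) (M : set 'rV[R]_(N + 1)) (e : R) :
  set 'rV[R]_(N + 1) := M `&` [set X | zcoord X <= 1 / e].

(* M is a hypersurface, of dimension m, of hyperbolic space of dimension m + 1. *)
Definition renormalized_area (m : nat) (M : set 'rV[R]_(m + 1 + 1)) (l : R) :
    Prop :=
  exists A : R -> R,
    (\forall e \near 0^'+, has_area m (truncation M e) (A e)%:E) /\
    constant_term A l.

End Hyperboloid.

Section Catenoid.
Context {R : realType}.

Definition sinh (x : R) : R := (expR x - expR (- x)) / 2.
Definition cosh (x : R) : R := (expR x + expR (- x)) / 2.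

Definition catenoid_Q (n : nat) (c : R) : {poly R} :=
  - 'X^(2 * n) + c ^+ 2 *: 'X + ((2 * n - 1)%N%:R ^+ 2)%:P.

Definition only_positive_root (p : {poly R}) (a : R) : Prop :=
  [/\ 0 < a, root p a & forall x, 0 < x -> root p x -> x = a].

Definition smooth (f : R -> R) : Prop := forall k x, derivable (derive1n k f) x 1.

(* These conditions determine u: the equation is singular at u = alpha, where
   smoothness and non-constancy force u < alpha for s <> 0. *)
Definition catenoid_profile (n : nat) (c alpha : R) (u : R -> R) : Prop :=
  [/\ smooth u,
      ~ (exists k, forall s, u s = k),
      forall s, 0 < u s <= alpha,
      forall s, derive1 u s ^+ 2 =
        4 * u s ^+ 2 / (2 * n - 1)%N%:R ^+ 2 * (catenoid_Q n c).[u s] &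
      u 0 = alpha].

(* The integral from 0 to s for s of either sign: the second term vanishes for
   s >= 0 and the first one for s <= 0. *)
Definition oriented_integral (f : R -> R) (s : R) : R :=
  \int[lebesgue_measure]_(x in `[0, s]) f x -
  \int[lebesgue_measure]_(x in `[s, 0]) f x.

Definition catenoid_v (n : nat) (c : R) (u : R -> R) (s : R) : R :=
  - c * oriented_integral
    (fun x => u x `^ (n%:R + 1 / 2) /
              (c ^+ 2 * u x + (2 * n - 1)%N%:R ^+ 2)) s.

Definition unit_sphere (m : nat) : set 'rV[R]_m :=
  [set w | \sum_(i < m) w 0 i ^+ 2 = 1].

Definition catenoid_point (n : nat) (c : R) (u : R -> R) (s : R)
    (w : 'rV[R]_(2 * n)) : 'rV[R]_(2 * n + 1 + 1) :=
  let rho := Num.sqrt (c ^+ 2 * u s + (2 * n - 1)%N%:R ^+ 2) in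
  (c * Num.sqrt (u s))^-1 *:
    row_mx (row_mx ((2 * n - 1)%N%:R *: w)
                   (rho * sinh (catenoid_v n c u s))%:M)
           (rho * cosh (catenoid_v n c u s))%:M.

Definition catenoid (n : nat) (c : R) (u : R -> R) :
    set 'rV[R]_(2 * n + 1 + 1) :=
  [set X | exists s w, unit_sphere w /\ X = catenoid_point c u s w].

Definition catenoid_q (n : nat) : {poly R} :=
  \sum_(1 <= i < n.+1)
    ((-1) ^+ i * 'C(n, i)%:R * (2 * n - 1)%N%:R ^+ (2 * (n - i)) *
     (2 * i - 1)%N%:R) *: 'X^(n * (2 * i - 1)).

End Catenoid.

Arguments catenoid {R} n c u.

(* Main.v *)
Require Import Defs.
From HB Require Import structures.
From mathcomp Require Import all_boot all_order all_algebra.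
From mathcomp Require Import all_classical all_reals all_analysis.
From mathcomp Require Import measurable_realfun.
From mathcomp Require Import ring lra zify.
Import Order.TTheory GRing.Theory Num.Theory.
Import numFieldNormedType.Exports.

Set Implicit Arguments.
Unset Strict Implicit.
Unset Printing Implicit Defensive.

Local Open Scope classical_set_scope.
Local Open Scope ring_scope.

(** Write M = 2n - 1 and y = sqrt u. The catenoid is swept out by the points
    (A w, X, Y) with A = M / (c y) and w on the unit sphere, and s is the arc
    length of the curve (A, X, Y). So the part of the catenoid over a set J of
    parameters has as area the volume of the sphere of dimension 2n - 1 times
    the integral over J of A^(2n-1). This is [rotational_area], which
    parametrizes the sphere by stereographic projection; [sphere_volume_odd]
    evaluates the volume of the sphere by Wallis integrals.

    The equation for u is quadratic in u', hence degenerate where u' = 0. With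
    T = - M u' / (2 u^(3/2)) it becomes the regular system
      y' = - y^2 T / M,   T' = (M + y^(4n)) / y,
      y^2 T^2 = c^2 y^2 + M^2 - y^(4n)
    of the record [catenoid_system]. Since T^2 - c^2 = (M^2 - y^(4n)) / y^2, the
    polynomial q_n is exactly what makes the density a total derivative up to
    an integrable term ([sys_radius_density]):
      (M / (c y))^(2n-1) = c^(1-2n) (y q_n(y^2) / M + (T^2 - c^2)^(n-1) T').

    On the half s >= 0, cut off at the height z = 1/e, the area is thus
    c^(1-2n) times the sum of two terms. The integral of y q_n(y^2) / M
    converges, as q_n(y^2) is O(y^(2n)) and y^(2n+1) is integrable. The
    substitution x = y^2, for which sqrt (x Q(x)) = y^2 T and
    dx = - (2 / M) y^3 T ds, turns its limit into half of the integral of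
    q_n / sqrt (x Q) over [0, alpha] ([sys_cvg_integral]). The other term is
    H(T), where H is the odd polynomial of degree 2n - 1 with
    H' = (t^2 - c^2)^(n-1). Along the end, T differs from c z / C by o(y^(2n-1)),
    where C is the limit of cosh v, while both have the size of 1/y; so H(T) is
    H(c z / C) up to a term that tends to 0 ([sys_poly_T_z]). At z = 1/e this is
    an odd polynomial in 1/e and does not contribute to the constant term. The
    half s <= 0 is the reflection of the half s >= 0, and gives the same
    constant term. *)

(** * Differential calculus on the line *)

Section Calculus.
Context {R : realType}.
Implicit Types (f g : R -> R) (x a b : R).

Lemma is_deriveM_fun f g x a b : is_derive x 1 f a -> is_derive x 1 g b ->
  is_derive x 1 (fun t => f t * g t) (a * g x + f x * b).
Proof.
move=> df dg; apply: (is_derive_eq (@is_deriveM _ _ f g x 1 a b df dg)).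
by rewrite addrC /GRing.scale/= [a * _]mulrC.
Qed.

Lemma is_deriveD_fun f g x a b : is_derive x 1 f a -> is_derive x 1 g b ->
  is_derive x 1 (fun t => f t + g t) (a + b).
Proof. exact: is_deriveD. Qed.

Lemma is_deriveB_fun f g x a b : is_derive x 1 f a -> is_derive x 1 g b ->
  is_derive x 1 (fun t => f t - g t) (a - b).
Proof. exact: is_deriveB. Qed.

Lemma is_deriveN_fun f x a : is_derive x 1 f a ->
  is_derive x 1 (fun t => - f t) (- a).
Proof. exact: is_deriveN. Qed.

Lemma is_deriveZ_fun f x a b : is_derive x 1 f a ->
  is_derive x 1 (fun t => b * f t) (b * a).
Proof. exact: is_deriveZ. Qed.

Lemma is_deriveV_fun f x a : f x != 0 -> is_derive x 1 f a ->
  is_derive x 1 (fun t => (f t)^-1) (- a / f x ^+ 2).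
Proof.
move=> f0 df; apply: (is_derive_eq (is_deriveV f0 df)).
by rewrite /GRing.scale/= mulNr mulrC mulNr.
Qed.

Lemma is_deriveX_fun f n x a : is_derive x 1 f a ->
  is_derive x 1 (fun t => f t ^+ n) (n%:R * f x ^+ n.-1 * a).
Proof.
move=> df; rewrite (_ : (fun t => f t ^+ n) = f ^+ n); last first.
  by apply/funext => t; elim: n => // n IH; rewrite !exprS IH.
apply: (is_derive_eq (@is_deriveX _ _ f n x 1 a df)).
by rewrite /GRing.scale/= -mulr_natl.
Qed.

Lemma is_derive_comp_fun f g x a b : is_derive (g x) 1 f a ->
  is_derive x 1 g b -> is_derive x 1 (fun t => f (g t)) (a * b).
Proof. exact: is_derive1_comp. Qed.

Lemma is_derive_sqrt_fun f x a : 0 < f x -> is_derive x 1 f a ->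
  is_derive x 1 (fun t => Num.sqrt (f t)) (a / (2 * Num.sqrt (f x))).
Proof.
move=> f0 df; apply: (is_derive_eq (is_derive_comp_fun (is_derive1_sqrt f0) df)).
by rewrite mulrC.
Qed.

Lemma is_derive_continuous f x a : is_derive x 1 f a -> {for x, continuous f}.
Proof.
move=> [df _]; exact/differentiable_continuous/derivable1_diffP.
Qed.

End Calculus.

Ltac derive_eq := notypeclasses refine (is_derive_eq _ _).

(** Differentiation by recursion on the expression, with the value of the
    derivative left as an existential variable. Apart from exp and
    arctan, a function without a visible body is differentiated by means of the
    hypotheses in the context. The goals that remain are
    the conditions that denominators are nonzero and radicands positive.
    Instance search is disabled in every step because it would try to guess
    the value. *)
Ltac der :=
  first [ notypeclasses refine (is_derive_cst _ _ _)
        | notypeclasses refine (is_derive_id _ _)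
        | match goal with
          | H : forall _, is_derive _ _ ?f _ |- is_derive _ _ ?f _ =>
              notypeclasses refine (H _)
          | H : is_derive _ _ ?f _ |- is_derive _ _ ?f _ => exact: H
          end
        | der_op ]
with der_op :=
  lazymatch goal with
  | |- is_derive _ _ (fun t => @?f t - @?g t) _ =>
      notypeclasses refine (@is_deriveB_fun _ f g _ _ _ _ _); der
  | |- is_derive _ _ (fun t => @?f t + @?g t) _ =>
      notypeclasses refine (@is_deriveD_fun _ f g _ _ _ _ _); der
  | |- is_derive _ _ (fun t => - @?f t) _ =>
      notypeclasses refine (@is_deriveN_fun _ f _ _ _); der
  | |- is_derive _ _ (fun t => @?f t * @?g t) _ =>
      first [ notypeclasses refine (@is_deriveZ_fun _ g _ _ _ _)
            | notypeclasses refine (@is_deriveM_fun _ f g _ _ _ _ _)]; der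
  | |- is_derive _ _ (fun t => (@?f t)^-1) _ =>
      notypeclasses refine (@is_deriveV_fun _ f _ _ _ _); [| der]
  | |- is_derive _ _ (fun t => (@?f t) ^+ ?n) _ =>
      notypeclasses refine (@is_deriveX_fun _ f n _ _ _); der
  | |- is_derive _ _ (fun t => Num.sqrt (@?f t)) _ =>
      notypeclasses refine (@is_derive_sqrt_fun _ f _ _ _ _); [| der]
  | |- is_derive _ _ (fun t => ?f t) _ => der_at f
  | |- is_derive _ _ (fun t => ?f (@?g t)) _ =>
      notypeclasses refine (@is_derive_comp_fun _ f g _ _ _ _ _);
      [der_at f | der]
  | |- is_derive _ _ ?f _ => der_at f
  end
with der_at f :=
  first [ match goal with H : forall _, is_derive _ _ f _ |- _ => apply: H end
        | match goal with H : is_derive _ _ f _ |- _ => apply: H end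
        | exact: is_derive_expR | exact: is_derive1_atan
        | idtac ].

Lemma cvgX_fun (R : realFieldType) (T : Type) (F : set_system T) {FF : Filter F}
  (f : T -> R) (l : R) k : f @ F --> l -> (fun x => f x ^+ k) @ F --> l ^+ k.
Proof.
move=> fl; elim: k => [|k IH]; first exact: cvg_cst.
under eq_fun do rewrite exprS.
by rewrite exprS; exact: cvgM.
Qed.

Lemma cvg_sum_fun (R : realFieldType) (T : Type) (F : set_system T) {FF : Filter F}
  k (f : 'I_k -> T -> R) (l : 'I_k -> R) : (forall i, f i @ F --> l i) ->
  (fun x => \sum_i f i x) @ F --> \sum_i l i.
Proof.
elim: k f l => [|k IH] f l fl.
  rewrite big_ord0; under eq_fun do rewrite big_ord0; exact: cvg_cst.
rewrite big_ord_recl; under eq_fun do rewrite big_ord_recl.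
by apply: cvgD => //; apply: IH.
Qed.

(** * Wallis integrals and the volume of odd-dimensional spheres *)

Section SphereVolume.
Context {R : realType}.
Local Notation mu := (@lebesgue_measure R).

(** The integral of (1 + x^2)^(-(k+2)/2) over the line. *)
Fixpoint wallis (k : nat) : R :=
  match k with
  | 0 => pi | 1 => 2 | k'.+2 => k'.+1%:R / k'.+2%:R * wallis k' end.

Lemma wallis_gt0 k : 0 < wallis k.
Proof.
suff: 0 < wallis k /\ 0 < wallis k.+1 by case.
elim: k => [|k [h1 h2]]; first by rewrite pi_gt0.
by split=> //=; rewrite mulr_gt0.
Qed.

Lemma wallis_mul k : wallis k * wallis k.+1 = 2 * pi / k.+1%:R.
Proof.
elim: k => [|k IH] /=; first by rewrite divr1 mulrC.
have h1 : k.+1%:R != 0 :> R by [].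
have h2 : k.+2%:R != 0 :> R by [].
transitivity (k.+1%:R / k.+2%:R * (wallis k * wallis k.+1)).
  by rewrite mulrCA mulrA [wallis k * _]mulrC mulrA.
by rewrite IH; move: (k.+1%:R) (k.+2%:R) h1 h2 => a b h1 h2; field; rewrite ?h1 ?h2.
Qed.

(** From m to m + 1 two Wallis integrals leave the product and four enter it,
    and two consecutive ones multiply to 2 pi / (k + 1). *)
Lemma sphere_volume_rec m : 2 ^+ (2 * m).+1 * \prod_(2 * m <= j < (4 * m).+1) wallis j =
  2 * pi ^+ m.+1 / m`!%:R.
Proof.
elim: m => [|m IH].
  by rewrite !muln0 big_nat1 fact0 !expr1 divr1.
have w0 k : wallis k != 0 by rewrite gt_eqF// wallis_gt0.
have E : wallis (2 * m) * (wallis (2 * m).+1 *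
   \prod_((2 * m.+1) <= j < (4 * m.+1).+1) wallis j) =
   (\prod_(2 * m <= j < (4 * m).+1) wallis j) * (wallis (4 * m).+1 *
   wallis (4 * m).+2 * (wallis (4 * m).+3 * wallis (4 * m).+4)).
  have -> : (2 * m.+1 = (2 * m).+2)%N by lia.
  have -> : (4 * m.+1 = (4 * m).+4)%N by lia.
  rewrite -big_ltn; last by lia.
  rewrite -big_ltn; last by lia.
  do 4 (rewrite big_nat_recr /=; last by lia).
  by rewrite -!mulrA.
rewrite mulrA wallis_mul !wallis_mul in E.
have nz k : k.+1%:R != 0 :> R by [].
have pi0 : pi != 0 :> R by rewrite gt_eqF// pi_gt0.
have -> : (2 * m.+1).+1 = ((2 * m).+1 + 2)%N by lia.
rewrite exprD -[X in X * _ = _]mulrC -mulrA.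
have -> : \prod_((2 * m.+1) <= j < (4 * m.+1).+1) wallis j =
    (\prod_(2 * m <= j < (4 * m).+1) wallis j) * (pi / (4 * m.+1%:R)).
  apply: (mulfI (_ : 2 * pi / (2 * m).+1%:R != 0)).
    by rewrite !mulf_neq0 ?invr_eq0.
  rewrite E.
  have -> : (4 * m).+2%:R = 2 * (2 * m).+1%:R :> R by rewrite -natrM; congr _%:R; lia.
  have -> : (4 * m).+4%:R = 4 * m.+1%:R :> R by rewrite -natrM; congr _%:R; lia.
  move: (nz m) (nz (2 * m)%N); move: (m.+1%:R) ((2 * m).+1%:R) => a b a0 b0.
  by field; rewrite ?a0 ?b0 ?f0 ?pi0.
have f0 : m`!%:R != 0 :> R by rewrite pnatr_eq0 -lt0n fact_gt0.
rewrite -[2 ^+ 2 * _ * _]mulrA [X in 2 ^+ 2 * X]mulrA IH factS natrM [in RHS]exprS.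
by move: (nz m); move: (m.+1%:R) => a a0; field; rewrite ?a0 ?b0 ?f0 ?pi0.
Qed.

End SphereVolume.

Section LineIntegral.
Context {R : realType}.
Local Notation mu := (@lebesgue_measure R).
Variable A : R.
Hypothesis A0 : 0 < A.
Let w (x : R) : R := Num.sqrt (A + x ^+ 2).

Let Ax_gt0 x : 0 < A + x ^+ 2. Proof. by rewrite ltr_pwDl ?sqr_ge0. Qed.
Let w_gt0 x : 0 < w x. Proof. by rewrite sqrtr_gt0. Qed.
Let w_neq0 x : w x != 0. Proof. by rewrite gt_eqF. Qed.
Let w_sqr x : w x ^+ 2 = A + x ^+ 2. Proof. by rewrite sqr_sqrtr// ltW. Qed.

Let le_w x : 0 <= x -> x <= w x.
Proof.
move=> x0; rewrite -[leLHS](ger0_norm x0) -sqrtr_sqr ler_sqrt ?lerDr ?ltW//.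
Qed.

Let is_derive_w (x : R) : is_derive x 1 w (x / w x).
Proof.
derive_eq; first by rewrite /w; der; exact: Ax_gt0.
by rewrite add0r expr1 mulr1 -mulf_div divff// mul1r.
Qed.

Let is_derive_wV k (x : R) : is_derive x 1 (fun t => (w t)^-1 ^+ k)
  (- k%:R * x * (w x)^-1 ^+ k.+2).
Proof.
have dw := is_derive_w; derive_eq; first by der; exact: w_neq0.
case: k => [|k]; first by rewrite !mul0r oppr0 !mul0r.
rewrite /= !exprS; field; exact: w_neq0.
Qed.

Let cvgy_wV : (w x)^-1 @[x --> +oo] --> 0.
Proof.
apply/gtr0_cvgV0; first exact: nearW.
apply: (ger_cvgy (f := id)); last exact: cvg_id.
by near=> x; apply: le_w; near: x; exact: nbhs_pinfty_ge.
Unshelve. all: by end_near. Qed.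

Let cvgy_xwV k : x * (w x)^-1 ^+ k.+2 @[x --> +oo] --> 0.
Proof.
apply: (squeeze_cvgr (f := fun=> 0) (h := fun x => (w x)^-1 ^+ k.+1)); last first.
- by have := cvgX_fun (k := k.+1) cvgy_wV; rewrite expr0n /=; exact.
- exact: cvg_cst.
near=> x; have x0 : 0 <= x by near: x; exact: nbhs_pinfty_ge.
rewrite mulr_ge0 ?exprn_ge0 ?invr_ge0 ?(ltW (w_gt0 _))//=.
rewrite exprS mulrA ger_pMl ?exprn_gt0 ?invr_gt0// ler_pdivrMr// mul1r.
exact: le_w.
Unshelve. all: by end_near. Qed.

Let cvgy_xw : x / w x @[x --> +oo] --> (1 : R).
Proof.
suff : Num.sqrt (1 - A * (w x)^-1 ^+ 2) @[x --> +oo] --> (1 : R).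
  apply: cvg_trans; apply: near_eq_cvg; near=> x.
  have x0 : 0 <= x by near: x; exact: nbhs_pinfty_ge.
  have -> : 1 - A * (w x)^-1 ^+ 2 = (x / w x) ^+ 2.
    by rewrite expr_div_n -exprVn exprVn !w_sqr; field; rewrite gt_eqF.
  by rewrite sqrtr_sqr ger0_norm// divr_ge0// ltW.
have {2}-> : (1 : R) = Num.sqrt (1 - A * 0 ^+ 2).
  by rewrite expr0n mulr0 subr0 sqrtr1.
apply: continuous_cvg; first exact: sqrt_continuous.
apply: cvgB; first exact: cvg_cst.
apply: cvgM; first exact: cvg_cst.
exact: cvgX_fun cvgy_wV.
Unshelve. all: by end_near. Qed.

(** The cases k = 0 and k = 1 have the primitives arctan and x / sqrt (A + x^2);
    integration by parts lowers k by 2. *)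
Let primitive k : exists F : R -> R, [/\ F 0 = 0,
  forall x : R, is_derive x 1 F ((w x)^-1 ^+ k.+2) &
  F x @[x --> +oo] --> wallis k / 2 * (Num.sqrt A)^-1 ^+ k.+1].
Proof.
pose s := Num.sqrt A.
have s0 : 0 < s by rewrite sqrtr_gt0.
have sE : s ^+ 2 = A by rewrite sqr_sqrtr// ltW.
pose P k := exists F : R -> R, [/\ F 0 = 0,
  forall x : R, is_derive x 1 F ((w x)^-1 ^+ k.+2) &
  F x @[x --> +oo] --> wallis k / 2 * s^-1 ^+ k.+1].
suff: P k /\ P k.+1 by case.
elim: k => [|k [Pk PSk]]; split=> //.
- exists (fun x => s^-1 * atan (s^-1 * x)); split.
  + by rewrite mulr0 atan0 mulr0.
  + move=> x; derive_eq; first by der.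
    rewrite exprVn w_sqr -sE; field; by rewrite sE !gt_eqF.
  + rewrite expr1 mulrC; apply: cvgM; first exact: cvg_cst.
    apply: (@cvg_comp _ _ _ (fun x => s^-1 * x) atan +oo); last exact: cvgy_atan.
    by apply: gt0_cvgMry; [rewrite invr_gt0|exact: cvg_id].
- exists (fun x => A^-1 * (x / w x)); split.
  + by rewrite mul0r mulr0.
  + move=> x; have dw := is_derive_w; derive_eq; first by der; exact: w_neq0.
    apply: (mulfI (lt0r_neq0 A0)); rewrite mulrA mulfV ?gt_eqF// mul1r.
    rewrite -[in RHS](addrK (x ^+ 2) A) -w_sqr; field; exact: w_neq0.
  + rewrite /= divff// mul1r exprVn sE -{2}(mulr1 A^-1).
    by apply: cvgM; [exact: cvg_cst | exact: cvgy_xw].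
- case: Pk => F [F0 dF Foo].
  exists (fun x => (A * k.+2%:R)^-1 * (k.+1%:R * F x + x * (w x)^-1 ^+ k.+2)); split.
  + by rewrite F0 mulr0 mul0r addr0 mulr0.
  + move=> x; have dw := is_derive_wV k.+2; derive_eq; first by der.
    apply: (mulfI (_ : A * k.+2%:R != 0)); first by rewrite mulf_neq0// gt_eqF.
    rewrite mulrA mulfV ?mulf_neq0 ?gt_eqF// mul1r.
    have EA : A = w x ^+ 2 - x ^+ 2 by rewrite w_sqr addrK.
    rewrite [X in _ = X * _ * _]EA; move: (w x) (w_neq0 x) => W W0.
    have -> : k.+2%:R = k.+1%:R + 1 :> R by rewrite natr1.
    by move: (k.+1%:R : R) => a; rewrite !exprS; field.
  + have -> : wallis k.+2 / 2 * s^-1 ^+ k.+3 = (A * k.+2%:R)^-1 * (k.+1%:R *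
       (wallis k / 2 * s^-1 ^+ k.+1) + 0) :> R.
      rewrite -sE /= (exprS _ k.+2) (exprS _ k.+1); move: (_ ^+ k.+1) => t.
      have : k.+2%:R != 0 :> R by []. move: (k.+2%:R) => b b0.
      by field; rewrite b0 gt_eqF.
    apply: cvgM; first exact: cvg_cst.
    apply: cvgD; last exact: cvgy_xwV.
    by apply: cvgM => //; exact: cvg_cst.
Qed.

Lemma integral_sqrtV k :
  (\int[mu]_x (((Num.sqrt (A + x ^+ 2))^-1 ^+ k.+2)%:E) =
   (wallis k * (Num.sqrt A)^-1 ^+ k.+1)%:E)%E.
Proof.
have cf : continuous (fun x => (w x)^-1 ^+ k.+2).
  by move=> x; exact: is_derive_continuous (is_derive_wV _ _).
rewrite (@ge0_symfun_integralT _ (fun x => (w x)^-1 ^+ k.+2)); last first.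
- by move=> x /=; rewrite /w sqrrN.
- exact: cf.
- by move=> x; rewrite exprn_ge0// invr_ge0 ltW.
case: (primitive k) => F [F0 dF Foo].
rewrite -set_itvcy (ge0_continuous_FTC2y _ _ Foo).
- by rewrite F0 sube0 -EFinM; congr EFin; field.
- by move=> x _; rewrite exprn_ge0// invr_ge0 ltW.
- exact: continuous_subspaceT.
- by move=> x _; case: (dF x).
- by apply: cvg_at_right_filter; exact: is_derive_continuous (dF 0).
- by move=> x _; rewrite derive1E; exact: derive_val.
Qed.

End LineIntegral.

Section TupleIntegral.
Context {R : realType}.
Local Notation mu := (@lebesgue_measure R).
Local Notation Rt m := (m.-tuple (measurableTypeR R)).

Lemma integral_lebesgue_tupleS d (f : Rt d.+1 -> \bar R) :
  measurable_fun [set: Rt d.+1] f -> (forall t, 0 <= f t)%E ->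
  (\int[lebesgue_tuple d.+1]_t f t =
   \int[mu]_x \int[lebesgue_tuple d]_t f (cons_pair (x, t)))%E.
Proof.
move=> mf f0.
transitivity (\int[pushforward (mu \x lebesgue_tuple d)%E (@cons_pair R d)]_t f t)%E => //.
rewrite (ge0_integral_pushforward (@measurable_cons_pair R d)) //.
rewrite preimage_setT (@fubini_tonelli1 _ _ _ _ _ mu (lebesgue_tuple d)) //; last first.
  by move=> x; exact: f0.
apply: measurableT_comp => //; exact: measurable_cons_pair.
Qed.

Lemma measurable_sqr_norm d :
  measurable_fun [set: Rt d] (fun t : Rt d => \sum_i tnth t i ^+ 2 : R).
Proof.
apply: measurable_sum => i /=; apply: measurable_funX.
exact: (measurable_tnth (T := measurableTypeR R)).
Qed.

Lemma measurable_sqrtV d (A : R) k : 0 < A ->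
  measurable_fun [set: Rt d] (fun t : Rt d =>
    (Num.sqrt (A + \sum_i tnth t i ^+ 2))^-1 ^+ k : R).
Proof.
move=> A0; pose g (y : R) := (Num.sqrt (A + `|y|))^-1 ^+ k.
rewrite (_ : (fun _ => _) = g \o (fun t : Rt d => \sum_i tnth t i ^+ 2)).
  apply: measurableT_comp; last exact: measurable_sqr_norm.
  apply: continuous_measurable_fun => y; apply: cvgX_fun; apply: cvgV.
    by rewrite gt_eqF// sqrtr_gt0 ltr_pwDl.
  apply: continuous_cvg; first exact: sqrt_continuous.
  by apply: cvgD; [exact: cvg_cst|apply: cvg_norm].
apply/funext => t; rewrite /g /= ger0_norm// sumr_ge0// => i _.
exact: sqr_ge0.
Qed.

(** Once the first coordinate x is fixed, the integrand has the same form in the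
    others, with A + x^2 in place of A; so each coordinate contributes one
    Wallis integral. *)
Lemma integral_tuple_sqrtV d (A : R) k : 0 < A ->
  (\int[lebesgue_tuple d]_t
     ((Num.sqrt (A + \sum_i tnth t i ^+ 2))^-1 ^+ (k.+1 + d))%:E =
   ((\prod_(k <= j < k + d) wallis j) * (Num.sqrt A)^-1 ^+ k.+1)%:E)%E.
Proof.
elim: d A k => [|d IH] A k A0.
  rewrite /= integral_dirac//; last first.
    by apply/measurable_EFinP; exact: measurable_sqrtV.
  by rewrite diracT mul1e big_ord0 !addn0 addr0 big_geq// mul1r.
rewrite integral_lebesgue_tupleS; first last.
- by move=> t; rewrite lee_fin exprn_ge0// invr_ge0 sqrtr_ge0.
- by apply/measurable_EFinP; exact: measurable_sqrtV.
transitivity (\int[mu]_x ((\prod_(k.+1 <= j < k.+1 + d) wallis j)%:E *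
    ((Num.sqrt (A + x ^+ 2))^-1 ^+ k.+2)%:E))%E.
  apply: eq_integral => x _.
  rewrite -EFinM -IH ?ltr_pwDl ?sqr_ge0//; apply: eq_integral => t _.
  rewrite big_ord_recl /= addrA addnS addSn; congr (((Num.sqrt (_ + _))^-1 ^+ _)%:E).
  by apply: eq_bigr => i _; rewrite !(tnth_nth 0).
rewrite ge0_integralZl_EFin//; first last.
- by rewrite prodr_ge0// => j _; rewrite ltW// wallis_gt0.
- apply/measurable_EFinP; apply: continuous_measurable_fun => x.
  apply: cvgX_fun; apply: cvgV; first by rewrite gt_eqF// sqrtr_gt0 ltr_pwDl ?sqr_ge0.
  apply: continuous_cvg; first exact: sqrt_continuous.
  by apply: cvgD; [exact: cvg_cst|apply: cvgX_fun; exact: cvg_id].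
rewrite integral_sqrtV// -EFinM; congr EFin.
by rewrite addnS -addSn mulrA [X in X * _]mulrC -big_ltn// addSn ltnS leq_addr.
Qed.

End TupleIntegral.

(** * Differentials of functions of several variables *)

Section Differential.
Context {R : realType} {V : normedModType R}.
Implicit Types (f g : V -> R) (p : V).

Lemma is_diffD_fun f g (a b : V -> R) p : is_diff p f a -> is_diff p g b ->
  is_diff p (fun q => f q + g q) (fun v => a v + b v).
Proof. by move=> df dg; apply: (is_diff_eq (is_diffD df dg)). Qed.

Lemma is_diffM_fun f g (a b : V -> R) p : is_diff p f a -> is_diff p g b ->
  is_diff p (fun q => f q * g q) (fun v => f p * b v + g p * a v).
Proof. by move=> df dg; apply: (is_diff_eq (is_diffM df dg)). Qed.

Lemma is_diff_comp_fun (f : R -> R) g (L : V -> R) p a : is_diff p g L ->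
  is_derive (g p) 1 f a -> is_diff p (fun q => f (g q)) (fun v => L v * a).
Proof.
move=> dg [df fa]; have dfd : differentiable f (g p) by exact/derivable1_diffP.
have df' : is_diff (g p) f (fun h => h * a).
  by apply: DiffDef => //; rewrite deriv1E// derive1E fa.
exact: (is_diff_eq (is_diff_comp dg df')).
Qed.

Lemma is_diff_sum_fun n (f L : 'I_n -> V -> R) p :
  (forall i, is_diff p (f i) (L i)) ->
  is_diff p (fun q => \sum_i f i q) (fun v => \sum_i L i v).
Proof.
elim: n f L => [|n IH] f L df.
  rewrite (_ : (fun q => _) = cst 0); last by apply/funext => q; rewrite big_ord0.
  apply: (is_diff_eq (is_diff_cst 0 p)).
  by apply/funext => v; rewrite big_ord0.
rewrite (_ : (fun q => _) = (fun q => f ord0 q + \sum_i f (lift ord0 i) q)).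
  rewrite [X in is_diff _ _ X](_ : _ = (fun v => L ord0 v + \sum_i L (lift ord0 i) v)).
    apply: is_diffD_fun => //; apply: (IH (fun i => f (lift ord0 i))) => i.
  by apply/funext => v; rewrite big_ord_recl.
by apply/funext => v; rewrite big_ord_recl.
Qed.

Lemma is_diff_row n (f : V -> 'rV[R]_n) (L : 'I_n -> V -> R) p :
  (forall j, is_diff p (fun q => f q 0 j) (L j)) ->
  differentiable f p /\ forall v, 'D_v f p = \row_j L j v.
Proof.
move=> df; have dfp : differentiable f p.
  rewrite (_ : f = \sum_j (fun q => f q 0 j *: delta_mx 0 j)); last first.
    apply/funext => q; rewrite [LHS]row_sum_delta fct_sumE.
    by apply: eq_bigr.
  apply: differentiable_sum => j; apply: differentiableZl.
  by case: (df j).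
split=> // v; rewrite derive_mx; last exact: diff_derivable.
by apply/matrixP => i j; rewrite !mxE ord1; case: (df j) => d e; rewrite deriveE// e.
Qed.

End Differential.

Section Jacobian.
Context {R : realType}.

Lemma is_diff_coord m (p : 'rV[R]_m) j :
  is_diff p (fun q : 'rV[R]_m => q 0 j : R) (fun v => v 0 j).
Proof.
have @f : {linear 'rV[R]_m -> R}.
  by exists (fun N : 'rV[R]_m => N 0 j); do 2![eexists]; do ?[constructor];
     rewrite ?mxE// => ? *; rewrite ?mxE//; move=> ?; rewrite !mxE.
rewrite (_ : (fun _ => _) = f) //; apply: DiffDef.
  exact/linear_differentiable/coord_continuous.
by rewrite diff_lin//; exact: coord_continuous.
Qed.

Lemma continuous_mx_fun (T : topologicalType) m n (f : T -> 'M[R]_(m, n)) p :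
  (forall i j, {for p, continuous (fun q => f q i j)}) -> {for p, continuous f}.
Proof.
move=> cf; rewrite (_ : f = \sum_i \sum_j (fun q => f q i j *: delta_mx i j)).
  elim/big_ind : _ => [|g h cg ch|i _]; first exact: cst_continuous.
    exact: continuousD.
  elim/big_ind : _ => [|g h cg ch|j _]; first exact: cst_continuous.
    exact: continuousD.
  by apply: cvgZr_tmp; exact: cf.
apply/funext => q; rewrite [LHS]matrix_sum_delta fct_sumE.
by apply: eq_bigr => i _; rewrite fct_sumE.
Qed.

End Jacobian.

(** * Points and first fundamental forms in block coordinates *)

Section Blocks.
Context {R : realType}.

(** A point of Minkowski space split into the rotated coordinates w, the axis
    coordinate x and the height y. *)
Definition rot_point N (w : 'rV[R]_N) (x y : R) : 'rV[R]_(N + 1 + 1) :=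
  row_mx (row_mx w x%:M) y%:M.

Lemma minkowski_rot N (w w' : 'rV[R]_N) x y x' y' :
  Defs.minkowski (rot_point w x y) (rot_point w' x' y') =
  \sum_j w 0 j * w' 0 j + x * x' - y * y'.
Proof.
rewrite /Defs.minkowski /zcoord /rot_point !row_mxKl !row_mxKr !mxE eqxx !mulr1n.
rewrite big_split_ord big_ord1 /= !row_mxEr !mxE eqxx !mulr1n; congr (_ + _ - _).
by apply: eq_bigr => j _; rewrite !row_mxEl.
Qed.

Lemma zcoord_rot N (w : 'rV[R]_N) x y : zcoord (rot_point w x y) = y.
Proof. by rewrite /zcoord row_mxKr mxE eqxx mulr1n. Qed.

Lemma rot_point_inj N (w w' : 'rV[R]_N) x y x' y' :
  rot_point w x y = rot_point w' x' y' -> [/\ w = w', x = x' & y = y'].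
Proof.
move=> /eq_row_mx[/eq_row_mx[-> e1] e2]; split=> //.
- by move/matrixP : e1 => /(_ 0 0); rewrite !mxE eqxx !mulr1n.
- by move/matrixP : e2 => /(_ 0 0); rewrite !mxE eqxx !mulr1n.
Qed.

Lemma is_diff_rot m N (w : 'rV[R]_m -> 'rV[R]_N) (x y : 'rV[R]_m -> R)
    (dw : 'I_N -> 'rV[R]_m -> R) (dx dy : 'rV[R]_m -> R) p :
  (forall j, is_diff p (fun q => w q 0 j) (dw j)) ->
  is_diff p x dx -> is_diff p y dy ->
  differentiable (fun q => rot_point (w q) (x q) (y q)) p /\
  forall v, 'D_v (fun q => rot_point (w q) (x q) (y q)) p =
    rot_point (\row_j dw j v) (dx v) (dy v).
Proof.
move=> hw hx hy.
pose L (j : 'I_(N + 1 + 1)) (v : 'rV[R]_m) : R :=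
  rot_point (\row_j dw j v) (dx v) (dy v) 0 j.
have := @is_diff_row _ _ _ (fun q => rot_point (w q) (x q) (y q)) L p.
case=> [j|? dE]; last by split=> // v; rewrite dE; apply/rowP => j; rewrite mxE.
rewrite /L /rot_point; case: (split_ordP j) => j' ->; last first.
  rewrite ord1; under eq_fun do rewrite row_mxEr mxE eqxx mulr1n.
  apply: (is_diff_eq hy); apply/funext => v.
  by rewrite row_mxEr mxE eqxx mulr1n.
under eq_fun do rewrite row_mxEl.
under [X in is_diff _ _ X]eq_fun do rewrite row_mxEl.
case: (split_ordP j') => k ->; last first.
  rewrite ord1; under eq_fun do rewrite row_mxEr mxE eqxx mulr1n.
  apply: (is_diff_eq hx); apply/funext => v.
  by rewrite row_mxEr mxE eqxx mulr1n.
under eq_fun do rewrite row_mxEl.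
apply: (is_diff_eq (hw k)); apply/funext => v.
by rewrite row_mxEl mxE.
Qed.

Lemma row_jacobian m N (f : 'rV[R]_m -> 'rV[R]_N) p i : differentiable f p ->
  row i (jacobian f p) = 'D_(delta_mx 0 i) f p.
Proof. by move=> df; rewrite deriveEjacobian// -rowE. Qed.

(** The first fundamental form is J G J^T, where G is the Minkowski form, so
    an invertible first form gives a right inverse of J. *)
Lemma first_form_row_free m N (f : 'rV[R]_m -> 'rV[R]_(N + 1)) p :
  \det (first_form f p) != 0 -> row_free (jacobian f p).
Proof.
move=> d0; set J := jacobian f p.
pose G : 'M[R]_(N + 1) := block_mx 1%:M 0 0 (- 1%:M).
have E : first_form f p = J *m (G *m J^T).
  apply/matrixP => i j; rewrite !mxE /Defs.minkowski -/J -(hsubmxK J).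
  rewrite tr_row_mx mul_block_col !mul1mx !mul0mx addr0 add0r mulNmx mul1mx.
  rewrite big_split_ord big_ord1 /zcoord; congr (_ + _).
    by apply: eq_bigr => k _; rewrite !row_row_mx !row_mxKl row_mxEl col_mxEu !mxE.
  rewrite !row_row_mx !row_mxKr row_mxEr col_mxEd !mxE.
  by rewrite mulrN (_ : ord0 = 0 :> 'I_1)//; exact/val_inj.
apply/row_freeP; exists (G *m J^T *m invmx (first_form f p)).
by rewrite mulmxA -E mulmxV// unitmxE unitfE.
Qed.

Lemma eq_continuous_at (T U : topologicalType) (f g : T -> U) p :
  f =1 g -> {for p, continuous g} -> {for p, continuous f}.
Proof. by move=> /funext ->. Qed.

Section ContinuousAt.
Variables (T : topologicalType) (p : T).
Implicit Types f g : T -> R.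

Lemma continuous_atM f g : {for p, continuous f} -> {for p, continuous g} ->
  {for p, continuous (fun q => f q * g q)}.
Proof. by move=> cf cg; exact: continuousM cf cg. Qed.

Lemma continuous_atD f g : {for p, continuous f} -> {for p, continuous g} ->
  {for p, continuous (fun q => f q + g q)}.
Proof. by move=> cf cg; exact: continuousD cf cg. Qed.

Lemma continuous_atN f : {for p, continuous f} ->
  {for p, continuous (fun q => - f q)}.
Proof. by move=> cf; exact: continuousN cf. Qed.

Lemma continuous_atX n f : {for p, continuous f} ->
  {for p, continuous (fun q => f q ^+ n)}.
Proof. by move=> cf; apply: cvgX_fun. Qed.

End ContinuousAt.

End Blocks.

(** * Rotational patches from stereographic projection *)

Section Stereographic.
Context {R : realType} (d : nat) (eps : R).
Hypothesis eps2 : eps ^+ 2 = 1.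
Implicit Types (p q v w : 'rV[R]_d.+1).

(** In the parameter space of a rotational hypersurface, coordinate 0 is the
    parameter of the generating curve; the others are the stereographic
    coordinates on the sphere. *)
Definition dot_tail p q : R := \sum_(k < d) p 0 (lift ord0 k) * q 0 (lift ord0 k).

(** Stereographic projection is conformal: it scales lengths by this factor. *)
Definition conformal_factor p : R := 2 / (1 + dot_tail p p).

(** The sign eps selects the pole of projection, the point whose coordinate 0 is
    eps and whose other coordinates vanish; it is the only point missed. *)
Definition stereographic p : 'rV[R]_d.+1 :=
  \row_j if unlift ord0 j is Some k then p 0 (lift ord0 k) * conformal_factor p
         else eps * (1 - conformal_factor p).

Local Notation lam := conformal_factor.

Lemma dot_tail_ge0 p : 0 <= dot_tail p p.
Proof. by apply: sumr_ge0 => k _; rewrite -expr2 sqr_ge0. Qed.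

Lemma conformal_factor_gt0 p : 0 < lam p.
Proof. by rewrite divr_gt0// ltr_pwDl// dot_tail_ge0. Qed.

Lemma conformal_factorE p : dot_tail p p = 2 / lam p - 1.
Proof.
rewrite /lam; have := dot_tail_ge0 p; move: (dot_tail _ _) => r r0.
by field; rewrite gt_eqF// ltr_pwDl.
Qed.

Lemma stereographic0 p : stereographic p 0 ord0 = eps * (1 - lam p).
Proof. by rewrite mxE unlift_none. Qed.

Lemma stereographicS p k :
  stereographic p 0 (lift ord0 k) = p 0 (lift ord0 k) * lam p.
Proof. by rewrite mxE liftK. Qed.

Lemma stereographic_unit p : unit_sphere (stereographic p).
Proof.
rewrite /unit_sphere /= big_ord_recl stereographic0.
under eq_bigr do rewrite stereographicS exprMn.
rewrite -big_distrl /= exprMn eps2 mul1r.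
have -> : \sum_(k < d) p 0 (lift ord0 k) ^+ 2 = dot_tail p p by [].
by rewrite conformal_factorE; field; rewrite gt_eqF// conformal_factor_gt0.
Qed.

Lemma stereographic_inj p q : stereographic p = stereographic q ->
  forall k, p 0 (lift ord0 k) = q 0 (lift ord0 k).
Proof.
move=> e k; have el : lam p = lam q.
  have := congr1 (fun r : 'rV[R]_d.+1 => eps * r 0 ord0) e.
  by rewrite !stereographic0 !mulrA -!expr2 eps2 !mul1r => /addrI/oppr_inj.
have := congr1 (fun r : 'rV[R]_d.+1 => r 0 (lift ord0 k)) e.
rewrite !stereographicS el => /mulIf; apply.
by rewrite gt_eqF// conformal_factor_gt0.
Qed.

Lemma stereographic_surj w (s : R) : unit_sphere w -> w 0 ord0 != eps ->
  exists2 p : 'rV[R]_d.+1, p 0 0 = s & stereographic p = w.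
Proof.
move=> w1 w0; pose l := 1 - eps * w 0 ord0.
have l0 : l != 0.
  apply: contra_neq w0; rewrite /l => /eqP; rewrite subr_eq0 => /eqP e.
  by rewrite -[LHS]mul1r -eps2 expr2 -mulrA -e mulr1.
pose p : 'rV[R]_d.+1 := \row_j if unlift ord0 j is Some k then w 0 (lift ord0 k) / l else s.
have pS k : p 0 (lift ord0 k) = w 0 (lift ord0 k) / l by rewrite mxE liftK.
have Ep : 1 + dot_tail p p = 2 / l.
  rewrite /dot_tail; under eq_bigr do rewrite pS -expr2 exprMn.
  rewrite -big_distrl /=.
  have -> : \sum_(k < d) w 0 (lift ord0 k) ^+ 2 = 1 - w 0 ord0 ^+ 2.
    by move: w1; rewrite /unit_sphere /= big_ord_recl => <-; rewrite addrC addKr.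
  have -> : 1 - w 0 ord0 ^+ 2 = l * (2 - l).
    by rewrite /l; ring: eps2.
  by field.
have El : lam p = l by rewrite /lam Ep; field.
exists p; first by rewrite mxE unlift_none.
apply/rowP => j; case: (unliftP ord0 j) => [k|] ->.
  by rewrite stereographicS pS El divfK.
by rewrite stereographic0 El /l opprB addrC subrK mulrA -expr2 eps2 mul1r.
Qed.

Lemma is_diff_dot_tail p :
  is_diff p (fun q => dot_tail q q) (fun v => 2 * dot_tail p v).
Proof.
apply: is_diff_eq.
  apply: (@is_diff_sum_fun R _ d (fun k q => q 0 (lift ord0 k) * q 0 (lift ord0 k))).
  by move=> k; apply: is_diffM_fun; exact: is_diff_coord.
apply/funext => v; rewrite /dot_tail big_distrr /=.
by apply: eq_bigr => k _; rewrite mulrDl mul1r.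
Qed.

Lemma is_diff_conformal_factor p :
  is_diff p lam (fun v => - lam p ^+ 2 * dot_tail p v).
Proof.
have r0 : 1 + dot_tail p p != 0 by rewrite gt_eqF// ltr_pwDl// dot_tail_ge0.
apply: is_diff_eq.
  apply: (@is_diff_comp_fun R _ (fun r => 2 * (1 + r)^-1)).
    exact: is_diff_dot_tail.
by apply/funext => v /=; rewrite /GRing.scale/= /lam; field.
Qed.

Definition d_stereographic p (j : 'I_d.+1) v : R :=
  if unlift ord0 j is Some k then
    p 0 (lift ord0 k) * (- lam p ^+ 2 * dot_tail p v) + lam p * v 0 (lift ord0 k)
  else eps * (lam p ^+ 2 * dot_tail p v).

Lemma is_diff_stereographic p j :
  is_diff p (fun q => stereographic q 0 j) (d_stereographic p j).
Proof.
case: (unliftP ord0 j) => [k|] -> {j}; rewrite /d_stereographic.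
  rewrite liftK; under eq_fun do rewrite stereographicS.
  by apply: is_diffM_fun; [exact: is_diff_coord|exact: is_diff_conformal_factor].
rewrite unlift_none; under eq_fun do rewrite stereographic0.
apply: is_diff_eq.
  apply: (@is_diff_comp_fun R _ (fun l => eps * (1 - l))).
    exact: is_diff_conformal_factor.
by apply/funext => v /=; rewrite /GRing.scale/=; ring.
Qed.

Section Patch.
Variables A X Y A' X' Y' : R -> R.
Hypothesis dA : forall s : R, is_derive s 1 A (A' s).
Hypothesis dX : forall s : R, is_derive s 1 X (X' s).
Hypothesis dY : forall s : R, is_derive s 1 Y (Y' s).
Hypothesis speed : forall s, A' s ^+ 2 + X' s ^+ 2 - Y' s ^+ 2 = 1.

Definition rot_patch p : 'rV[R]_(d.+1 + 1 + 1) :=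
  rot_point (A (p 0 0) *: stereographic p) (X (p 0 0)) (Y (p 0 0)).

Definition d_rot_patch p v : 'rV[R]_(d.+1 + 1 + 1) :=
  rot_point (\row_j (A (p 0 0) * d_stereographic p j v +
                     stereographic p 0 j * (v 0 0 * A' (p 0 0))))
            (v 0 0 * X' (p 0 0)) (v 0 0 * Y' (p 0 0)).

Lemma is_diff_rot_patch p : differentiable rot_patch p /\
  forall v, 'D_v rot_patch p = d_rot_patch p v.
Proof.
apply: is_diff_rot => [j||].
- under eq_fun do rewrite mxE.
  apply: is_diffM_fun; last exact: is_diff_stereographic.
  by apply: is_diff_comp_fun (dA _); exact: is_diff_coord.
- by apply: is_diff_comp_fun (dX _); exact: is_diff_coord.
- by apply: is_diff_comp_fun (dY _); exact: is_diff_coord.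
Qed.

(** The induced metric is ds^2 + (A lambda)^2 |dx|^2: the curve has unit speed,
    the sphere metric is lambda^2 |dx|^2, and the mixed terms vanish because
    the stereographic point has constant norm. *)
Lemma minkowski_d_rot_patch p v w :
  Defs.minkowski (d_rot_patch p v) (d_rot_patch p w) =
  v 0 0 * w 0 0 + (A (p 0 0) * lam p) ^+ 2 * dot_tail v w.
Proof.
rewrite minkowski_rot big_ord_recl !mxE /d_stereographic unlift_none.
under eq_bigr do rewrite !mxE !liftK.
set a := A _; set a' := A' _; set x' := X' _; set y' := Y' _.
set l := lam p; set pv := dot_tail p v; set pw := dot_tail p w.
set v0 : R := v 0 0; set w0 : R := w 0 0.
pose al := l * (v0 * a') - a * (l ^+ 2 * pv); pose ga := l * (w0 * a') - a * (l ^+ 2 * pw).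
rewrite (eq_bigr (fun k =>
   (al * ga) * (p 0 (lift ord0 k) * p 0 (lift ord0 k)) +
   ((al * (a * l)) * (p 0 (lift ord0 k) * w 0 (lift ord0 k)) +
   (((a * l) * ga) * (p 0 (lift ord0 k) * v 0 (lift ord0 k)) +
   (a * l) ^+ 2 * (v 0 (lift ord0 k) * w 0 (lift ord0 k))))));
  last by move=> k _; rewrite /al /ga; ring.
rewrite !big_split /= -!big_distrr /=.
rewrite -/(dot_tail p p) -/(dot_tail p w) -/(dot_tail p v) -/(dot_tail v w) -/pv -/pw.
have sp : y' ^+ 2 = a' ^+ 2 + x' ^+ 2 - 1.
  by rewrite -(speed (p 0 0)) opprB addrC subrK.
have l0 : l != 0 by rewrite gt_eqF// conformal_factor_gt0.
rewrite conformal_factorE -/l /al /ga.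
have -> : v0 * y' * (w0 * y') = v0 * w0 * y' ^+ 2 by ring.
rewrite sp; field: eps2.
exact: l0.
Qed.

Lemma first_form_rot_patch p : first_form rot_patch p =
  diag_mx (\row_i if i == ord0 then 1 else (A (p 0 0) * lam p) ^+ 2).
Proof.
have [dp dE] := is_diff_rot_patch p.
have z : (0 : 'I_d.+1) = ord0 by exact/val_inj.
apply/matrixP => i j; rewrite !mxE !row_jacobian// !dE minkowski_d_rot_patch.
rewrite !mxE /dot_tail z !eqxx /=.
under eq_bigr do rewrite !mxE !eqxx /=.
case: (unliftP ord0 i) => [k|] ->; last first.
  rewrite big1 => [|k _]; last first.
    by rewrite [lift _ _ == _]eq_sym (negbTE (neq_lift _ _)) mul0r.
  by rewrite eqxx mul1r mulr0 addr0; case: eqP => _; rewrite ?mulr1n ?mulr0n.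
rewrite (bigD1 k)//= big1 ?addr0 => [|k' kk']; last first.
  by rewrite (inj_eq lift_inj) (negbTE kk') mul0r.
by rewrite mul0r add0r eqxx mul1r; case: eqP => _; rewrite ?mulr1 ?mulr0 ?mulr1n ?mulr0n.
Qed.

Lemma det_first_form_rot_patch p :
  \det (first_form rot_patch p) = (A (p 0 0) * lam p) ^+ (2 * d).
Proof.
rewrite first_form_rot_patch det_diag big_ord_recl !mxE eqxx mul1r.
under eq_bigr do rewrite mxE.
by rewrite prodr_const card_ord exprM.
Qed.

Hypothesis cA' : continuous A'.
Hypothesis cX' : continuous X'.
Hypothesis cY' : continuous Y'.

Lemma continuous_rot_patch_jacobian p : {for p, continuous (jacobian rot_patch)}.
Proof.
have cco j : {for p, continuous (fun q => q 0 j : R)}.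
  by case: (is_diff_coord p j) => /differentiable_continuous.
have c0 (f : R -> R) : continuous f -> {for p, continuous (fun q => f (q 0 0))}.
  by move=> cf; apply: (@continuous_comp _ _ _ (fun q => q 0 0 : R)); [exact: cco|exact: cf].
have cA : continuous A by move=> s; exact: is_derive_continuous (dA s).
have cl : {for p, continuous lam}.
  by case: (is_diff_conformal_factor p) => /differentiable_continuous.
have cdot v : {for p, continuous (fun q => dot_tail q v)}.
  have : is_diff p (fun q => dot_tail q v)
      (fun u => \sum_(k < d) (u 0 (lift ord0 k) * v 0 (lift ord0 k))).
    apply: (@is_diff_sum_fun R _ d (fun k q => q 0 (lift ord0 k) * v 0 (lift ord0 k))).
    move=> k; apply: (is_diff_comp_fun (f := fun r => r * v 0 (lift ord0 k))).
      exact: is_diff_coord.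
    by derive_eq; [der | rewrite mulr0 addr0 mul1r].
  by case=> /differentiable_continuous.
apply: continuous_mx_fun => i j.
rewrite (_ : (fun q => _) = (fun q => d_rot_patch q (delta_mx 0 i) 0 j)); last first.
  apply/funext => q; have [dq dE] := is_diff_rot_patch q.
  by rewrite -dE -row_jacobian// [RHS]mxE.
pose e0 : R := (delta_mx 0 i : 'rV[R]_d.+1) 0 0.
rewrite /d_rot_patch /rot_point; case: (split_ordP j) => j' ->; last first.
  apply: (eq_continuous_at (g := fun q => e0 * Y' (q 0 0))) => [q|].
    by rewrite row_mxEr (ord1 j') mxE eqxx mulr1n.
  by apply: continuous_atM; [exact: cst_continuous|exact: (c0 _ cY')].
case: (split_ordP j') => k ->; last first.
  apply: (eq_continuous_at (g := fun q => e0 * X' (q 0 0))) => [q|].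
    by rewrite row_mxEl row_mxEr (ord1 k) mxE eqxx mulr1n.
  by apply: continuous_atM; [exact: cst_continuous|exact: (c0 _ cX')].
apply: (eq_continuous_at (g := fun q => A (q 0 0) * d_stereographic q k (delta_mx 0 i) +
    stereographic q 0 k * (e0 * A' (q 0 0)))) => [q|].
  by rewrite row_mxEl row_mxEl mxE.
have cdl : {for p, continuous (fun q => lam q ^+ 2 * dot_tail q (delta_mx 0 i))}.
  by apply: continuous_atM; [exact: continuous_atX|exact: cdot].
apply: continuous_atD; apply: continuous_atM.
- exact: (c0 _ cA).
- rewrite /d_stereographic; case: (unliftP ord0 k) => [k'|] _.
    apply: continuous_atD; apply: continuous_atM; [exact: cco| |exact: cl|exact: cst_continuous].
    apply: (eq_continuous_at (g := fun q => - (lam q ^+ 2 * dot_tail q (delta_mx 0 i)))) => [q|].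
      by rewrite mulNr.
    by apply: continuous_atN.
  by apply: continuous_atM; [exact: cst_continuous|exact: cdl].
- case: (is_diff_stereographic p k) => + _.
  exact: differentiable_continuous.
- by apply: continuous_atM; [exact: cst_continuous|exact: (c0 _ cA')].
Qed.

Hypothesis A0 : forall s, 0 < A s.
Hypothesis Y0 : forall s, 0 < Y s.
Hypothesis hyp : forall s, A s ^+ 2 + X s ^+ 2 - Y s ^+ 2 = -1.
Hypothesis profile_inj : forall s t, A s = A t -> X s = X t -> Y s = Y t -> s = t.

(** The hyperboloid equation recovers A from X and Y, and then w from A w. *)
Lemma rot_point_inj_profile (w w' : 'rV[R]_d.+1) s s' :
  rot_point (A s *: w) (X s) (Y s) = rot_point (A s' *: w') (X s') (Y s') ->
  s = s' /\ w = w'.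
Proof.
move=> /rot_point_inj[e eX eY].
have eA : A s = A s'.
  apply/eqP; rewrite -(eqrXn2 (n := 2))// ?ltW//; apply/eqP.
  have := hyp s; have := hyp s'; rewrite eX eY => <- /(congr1 (fun r => r + Y s' ^+ 2 - X s' ^+ 2)).
  by rewrite !subrK !addrK.
split; first exact: profile_inj.
have AN0 : A s' != 0 by rewrite gt_eqF.
by rewrite -(scalerK AN0 w) -(scalerK AN0 w') -e eA.
Qed.

Lemma regular_rot_patch : regular_patch setT rot_patch.
Proof.
split.
- exact: openT.
- split=> p _; first by case: (is_diff_rot_patch p).
  exact: continuous_rot_patch_jacobian.
- move=> p _; apply: first_form_row_free; rewrite det_first_form_rot_patch.
  by rewrite expf_neq0// mulf_neq0// gt_eqF// conformal_factor_gt0.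
- move=> p q _ _ /rot_point_inj_profile[e0 /stereographic_inj e].
  by apply/rowP => j; case: (unliftP ord0 j) => [k|] ->.
- move=> p _; split; last by rewrite zcoord_rot.
  rewrite minkowski_rot; under eq_bigr do rewrite !mxE.
  rewrite (eq_bigr (fun j => A (p 0 0) ^+ 2 * stereographic p 0 j ^+ 2)) => [|j _].
    by rewrite -big_distrr /= stereographic_unit mulr1 -!expr2.
  by rewrite mxE -expr2 exprMn.
Qed.

End Patch.

End Stereographic.

(** * The area of a rotational hypersurface *)

Section RotationalArea.
Context {R : realType}.
Local Notation mu := (@lebesgue_measure R).
Local Notation Rt m := (m.-tuple (measurableTypeR R)).

Lemma tnth_tail d (t : Rt d.+1) (i : 'I_d) :
  tnth [tuple of behead t] i = tnth t (lift ord0 i).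
Proof.
by rewrite tnth_behead; congr tnth; apply/val_inj; rewrite /= inordK ?ltnS.
Qed.

Lemma lebesgue_tuple_cons d (J : set R) (Z : set (Rt d)) :
  measurable J -> measurable Z ->
  lebesgue_tuple d.+1 [set t : Rt d.+1 | J (thead t) /\ Z [tuple of behead t]] =
  (mu J * lebesgue_tuple d Z)%E.
Proof.
move=> mJ mZ.
transitivity ((mu \x lebesgue_tuple d)%E (J `*` Z)); last exact: product_measure1E.
rewrite /= /lebesgue_cons /pushforward; congr (_ _).
apply/seteqP; split=> [[x t]|[x t]] [/= h1 h2]; split=> //=.
  by move: h2; congr (Z _); exact/val_inj.
by move: h2; congr (Z _); exact/val_inj.
Qed.

Lemma measurable_tuple_origin d :
  measurable [set t : Rt d | \sum_i tnth t i ^+ 2 = 0].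
Proof.
rewrite -[X in measurable X]setTI.
exact: (@measurable_sqr_norm R d measurableT [set 0]).
Qed.

Lemma lebesgue_tuple_origin d :
  lebesgue_tuple d.+1 [set t : Rt d.+1 | \sum_i tnth t i ^+ 2 = 0] = 0%E.
Proof.
rewrite (_ : [set t | _] = [set t : Rt d.+1 | [set 0] (thead t) /\
   [set t : Rt d | \sum_i tnth t i ^+ 2 = 0] [tuple of behead t]]).
  rewrite lebesgue_tuple_cons//; last exact: measurable_tuple_origin.
  by rewrite lebesgue_measure_set1 mul0e.
have E (t : Rt d.+1) : \sum_i tnth t i ^+ 2 = thead t ^+ 2 +
    \sum_i tnth [tuple of behead t] i ^+ 2.
  rewrite big_ord_recl; congr (_ + _); apply: eq_bigr => i _.
  by rewrite tnth_tail.
have S0 (t : Rt d) : 0 <= \sum_i tnth t i ^+ 2.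
  by apply: sumr_ge0 => i _; exact: sqr_ge0.
apply/seteqP; split=> t /=; rewrite E.
  move/eqP; rewrite paddr_eq0 ?sqr_ge0// => /andP[].
  by rewrite sqrf_eq0 => /eqP -> /eqP.
by move=> [-> ->]; rewrite expr0n addr0.
Qed.

(** The integral of the density (2 / (1 + |x|^2))^d of stereographic
    coordinates over R^d, one Wallis factor for each coordinate. *)
Definition sphere_volume (d : nat) : R :=
  2 ^+ d * \prod_(d.-1 <= j < d.-1 + d) wallis j.

Lemma integral_stereographic d : (0 < d)%N ->
  (\int[lebesgue_tuple d]_t ((2 / (1 + \sum_i tnth t i ^+ 2)) ^+ d)%:E =
   (sphere_volume d)%:E)%E.
Proof.
case: d => // e _.
transitivity (\int[lebesgue_tuple e.+1]_t ((2 ^+ e.+1)%:E *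
   ((Num.sqrt ((1 : R) + \sum_i tnth t i ^+ 2))^-1 ^+ (e.+1 + e.+1))%:E))%E.
  apply: eq_integral => t _; rewrite -EFinM; congr EFin.
  rewrite exprMn addnn -mul2n exprM; congr (_ * _ ^+ _).
  rewrite exprVn sqr_sqrtr// addr_ge0// sumr_ge0// => i _; exact: sqr_ge0.
rewrite ge0_integralZl_EFin//.
- by rewrite integral_tuple_sqrtV// sqrtr1 invr1 expr1n mulr1 -EFinM.
- by apply/measurable_EFinP; exact: measurable_sqrtV.
Qed.

Variable d : nat.
Hypothesis d0 : (0 < d)%N.
Variables A X Y A' X' Y' : R -> R.
Hypothesis dA : forall s : R, is_derive s 1 A (A' s).
Hypothesis dX : forall s : R, is_derive s 1 X (X' s).
Hypothesis dY : forall s : R, is_derive s 1 Y (Y' s).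
Hypothesis cA' : continuous A'.
Hypothesis cX' : continuous X'.
Hypothesis cY' : continuous Y'.
Hypothesis speed : forall s, A' s ^+ 2 + X' s ^+ 2 - Y' s ^+ 2 = 1.
Hypothesis A0 : forall s, 0 < A s.
Hypothesis Y0 : forall s, 0 < Y s.
Hypothesis hyp : forall s, A s ^+ 2 + X s ^+ 2 - Y s ^+ 2 = -1.
Hypothesis profile_inj : forall s t, A s = A t -> X s = X t -> Y s = Y t -> s = t.
Variable J : set R.
Hypothesis mJ : measurable J.

Let tail2 (t : Rt d.+1) : R := \sum_(k < d) tnth t (lift ord0 k) ^+ 2.

Let tail2E (t : Rt d.+1) : tail2 t = dot_tail (row_of_tuple t) (row_of_tuple t).
Proof. by apply: eq_bigr => k _; rewrite !mxE -expr2. Qed.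

Let row0 (t : Rt d.+1) : row_of_tuple t 0 0 = thead t.
Proof. by rewrite mxE; congr tnth; exact/val_inj. Qed.

Let m_tail2 : measurable_fun [set: Rt d.+1] (tail2 : Rt d.+1 -> R).
Proof.
apply: measurable_sum => i /=; apply: measurable_funX.
exact: (measurable_tnth (T := measurableTypeR R)).
Qed.

Let m_thead : measurable_fun [set: Rt d.+1] (fun t : Rt d.+1 => thead t : measurableTypeR R).
Proof. exact: (measurable_tnth (T := measurableTypeR R) ord0). Qed.

Let E0 : set (Rt d.+1) := [set t | J (thead t)].
Let E1 : set (Rt d.+1) := [set t | J (thead t) /\ tail2 t = 0].

Let mE0 : measurable E0.
Proof. by rewrite -[E0]setTI; exact: m_thead. Qed.

Let mE1 : measurable E1.
Proof.
rewrite (_ : E1 = E0 `&` (setT `&` (tail2 @^-1` [set 0]))).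
  have m1 := @m_tail2 measurableT [set 0] (measurable_set1 _).
  exact: (measurableI _ _ mE0 m1).
by rewrite setTI.
Qed.

Let dens (t : Rt d.+1) : R := (A (thead t) * (2 / (1 + tail2 t))) ^+ d.

Let dens_ge0 t : 0 <= dens t.
Proof.
rewrite exprn_ge0// mulr_ge0 ?(ltW (A0 _))// divr_ge0// addr_ge0// tail2E.
exact: dot_tail_ge0.
Qed.

Let cA : continuous A. Proof. by move=> s; exact: is_derive_continuous (dA s). Qed.

Let m_dens : measurable_fun [set: Rt d.+1] (dens : Rt d.+1 -> R).
Proof.
apply: measurable_funX; apply: measurable_funM.
  exact: (measurableT_comp (continuous_measurable_fun cA) m_thead).
rewrite (_ : (fun _ => _) = (fun r : R => 2 / (1 + `|r|)) \o (tail2 : Rt d.+1 -> R)).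
  apply: measurableT_comp; last exact: m_tail2.
  apply: continuous_measurable_fun => r.
  apply: cvgM; first exact: cvg_cst.
  apply: cvgV; first by rewrite gt_eqF// ltr_pwDl.
  by apply: cvgD; [exact: cvg_cst|apply: cvg_norm].
apply/funext => t /=; rewrite ger0_norm// tail2E; exact: dot_tail_ge0.
Qed.

Let det_dens eps t :
  eps ^+ 2 = 1 ->
  Num.sqrt (\det (first_form (rot_patch eps A X Y (d := d)) (row_of_tuple t))) = dens t.
Proof.
move=> eps2; rewrite (det_first_form_rot_patch eps2 dA dX dY speed) exprM -exprAC sqrtr_sqr.
rewrite row0 /conformal_factor -tail2E ger0_norm//; exact: dens_ge0.
Qed.

Let integral_dens : (\int[lebesgue_tuple d.+1]_(t in E0) (dens t)%:E =
  (sphere_volume d)%:E * \int[mu]_(s in J) (A s ^+ d)%:E)%E.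
Proof.
have AJ0 s : 0 <= ((fun s => A s ^+ d) \_ J) s.
  by rewrite patchE; case: ifPn => // _; rewrite exprn_ge0// ltW.
have mAJ : measurable_fun setT ((fun s => A s ^+ d) \_ J).
  apply/(measurable_restrict _ mJ) => //; rewrite setTI.
  apply: measurable_funTS; apply: measurable_funX; exact: continuous_measurable_fun cA.
rewrite integral_mkcond integral_lebesgue_tupleS; first last.
- move=> t; rewrite patchE; case: ifPn => // _; rewrite lee_fin; exact: dens_ge0.
- apply/(measurable_restrict _ mE0) => //; rewrite setTI.
  by apply: measurable_funTS; apply/measurable_EFinP; exact: m_dens.
transitivity (\int[mu]_s ((sphere_volume d)%:E * (((fun s => A s ^+ d) \_ J) s)%:E))%E.
  apply: eq_integral => s _.
  transitivity (\int[lebesgue_tuple d]_t ((((fun s => A s ^+ d) \_ J) s)%:E *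
     ((2 / (1 + \sum_i tnth t i ^+ 2)) ^+ d)%:E))%E.
    apply: eq_integral => t _; rewrite !patchE.
    have -> : (cons_pair (s, t) \in E0) = (s \in J).
      by apply/idP/idP; rewrite !inE.
    case: ifPn => _; last by rewrite mul0e.
    rewrite -EFinM -exprMn; congr (((_ * (2 / (1 + _))) ^+ d)%:E).
    by apply: eq_bigr => i _; rewrite !(tnth_nth 0).
  rewrite ge0_integralZl_EFin//.
  - by rewrite integral_stereographic// muleC.
  - move=> t _; rewrite lee_fin exprn_ge0// divr_ge0// addr_ge0// sumr_ge0// => i _.
    exact: sqr_ge0.
  - apply/measurable_EFinP; apply: measurable_funX.
    apply: measurable_funM => //.
    have := @measurable_sqrtV R d 1 2 ltr01; congr (measurable_fun _ _).
    apply/funext => t; rewrite exprVn sqr_sqrtr// addr_ge0// sumr_ge0// => i _.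
    exact: sqr_ge0.
have sv0 : 0 <= sphere_volume d.
  by rewrite mulr_ge0// ?exprn_ge0// prodr_ge0// => j _; rewrite ltW// wallis_gt0.
rewrite ge0_integralZl_EFin//; first last.
- exact/measurable_EFinP.
- by move=> s _; rewrite lee_fin; exact: AJ0.
by rewrite [in RHS]integral_mkcond; congr (_ * _)%E; apply: eq_integral => s _;
  rewrite !patchE; case: ifP.
Qed.

Let lebesgue_E1 : lebesgue_tuple d.+1 E1 = 0%E.
Proof.
have := lebesgue_tuple_cons mJ (measurable_tuple_origin (d := d)).
rewrite (_ : [set t | _] = E1).
  move=> ->; case: d d0 => // e _; rewrite lebesgue_tuple_origin mule0//.
have E (t : Rt d.+1) : tail2 t = \sum_i tnth [tuple of behead t] i ^+ 2.
  apply: eq_bigr => i _.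
  by rewrite tnth_tail.
by apply/seteqP; split=> t /= [h1 h2]; split; rewrite ?E// -E.
Qed.

(** Stereographic projection from the pole w_0 = 1 covers everything but that
    pole; the missing curve is the trace of a second projection, from the
    opposite pole, on a null set of parameters. *)
Lemma rotational_area :
  has_area d.+1 [set P | exists s w, [/\ J s, unit_sphere w &
     P = rot_point ((A s *: w) : 'rV[R]_d.+1) (X s) (Y s)]]
   ((sphere_volume d)%:E * \int[mu]_(s in J) (A s ^+ d)%:E)%E.
Proof.
pose eps (k : nat) : R := if k == 1%N then -1 else 1.
have eps2 k : eps k ^+ 2 = 1 by rewrite /eps; case: ifP; rewrite ?sqrrN expr1n.
pose E (k : nat) := if k is 0 then E0 else if k is 1%N then E1 else set0.
exists (fun=> setT), (fun k => rot_patch (eps k) A X Y (d := d)), E; split.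
- by move=> k; exact: (@regular_rot_patch _ _ _ (eps2 k) _ _ _ A' X' Y').
- move=> k; split=> //; case: k => [|[|k]]; [exact: mE0|exact: mE1|exact: measurable0].
- apply/seteqP; split=> P.
    move=> [s [w [Js w1 ->]]].
    have [w0|w0] := eqVneq (w 0 ord0) 1; last first.
      have [p p0 pw] := stereographic_surj (eps2 0%N) s w1 w0.
      exists 0%N => //; exists [tuple p 0 i | i < d.+1].
        by rewrite /E /E0 /= (_ : thead _ = s)// -p0 [LHS]tnth_mktuple; congr (p _ _); exact/val_inj.
      have -> : (rot_patch (eps 0%N) A X Y \o row_of_tuple (m := d.+1))
          [tuple p 0 i | i < d.+1] = rot_patch (eps 0%N) A X Y p.
        by rewrite /=; congr rot_patch; apply/rowP => j; rewrite mxE tnth_mktuple.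
      by rewrite /rot_patch p0 pw.
    have w1' : w 0 ord0 != eps 1%N by rewrite w0 /eps /=; apply/negP => /eqP; lra.
    have [p p0 pw] := stereographic_surj (eps2 1%N) s w1 w1'.
    exists 1%N => //; exists [tuple p 0 i | i < d.+1].
      split; first by rewrite (_ : thead _ = s)// -p0 [LHS]tnth_mktuple; congr (p _ _); exact/val_inj.
      have : stereographic (eps 1%N) p 0 ord0 = 1 by rewrite pw.
      rewrite stereographic0 /eps /= mulN1r opprB => /(congr1 (fun r => r + 1)).
      rewrite subrK => l2; rewrite tail2E.
      rewrite (_ : row_of_tuple _ = p); last by apply/rowP => j; rewrite mxE tnth_mktuple.
      by rewrite conformal_factorE l2; field.
    have -> : (rot_patch (eps 1%N) A X Y \o row_of_tuple (m := d.+1))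
        [tuple p 0 i | i < d.+1] = rot_patch (eps 1%N) A X Y p.
      by rewrite /=; congr rot_patch; apply/rowP => j; rewrite mxE tnth_mktuple.
    by rewrite /rot_patch p0 pw.
  move=> [k _ [t Et <-]].
  exists (thead t), (stereographic (eps k) (row_of_tuple t)); split.
  - by case: k Et => [|[|k]] // [].
  - exact: stereographic_unit.
  - by rewrite /= /rot_patch row0.
- have key t t' : E0 t -> E1 t' -> rot_patch (eps 0%N) A X Y (row_of_tuple t) =
     rot_patch (eps 1%N) A X Y (row_of_tuple t') -> False.
    move=> Et [_ t'0] /(rot_point_inj_profile A0 hyp profile_inj)[_].
    move=> /(congr1 (fun r : 'rV[R]_d.+1 => r 0 ord0)).
    rewrite !stereographic0 /conformal_factor -!tail2E t'0 /eps /= => e.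
    have e2 : 2 / (1 + 0) = 2 :> R by rewrite addr0 divr1.
    rewrite e2 in e.
    have := conformal_factor_gt0 (row_of_tuple t).
    rewrite /conformal_factor -tail2E => l0.
    have : 2 / (1 + tail2 t) = 0 :> R by lra.
    by move=> l1; rewrite l1 ltxx in l0.
  apply/trivIsetP => i j _ _ ij; rewrite -subset0 => P [[t Et <-] [t' Et' /= e]].
  case: i j ij Et Et' e => [|[|i]] [|[|j]] // _ Et Et' e; last exact: key e.
  by apply: (key _ _ Et Et'); rewrite e.
- rewrite nneseries_recl//; last first.
    by move=> k _; apply: integral_ge0 => t _; rewrite lee_fin sqrtr_ge0.
  rewrite eseries0; last first.
    move=> [|[|k]] // _ _ /=; last by rewrite integral_set0.
    under eq_integral do rewrite det_dens//.
    apply: null_set_integral => //.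
    by apply: measurable_funTS; apply/measurable_EFinP; exact: m_dens.
  rewrite adde0 -integral_dens /=; apply: eq_integral => t _.
  by rewrite det_dens.
Qed.

End RotationalArea.

(** * Monotonicity and the fundamental theorem of calculus *)

Section RealAnalysis.
Context {R : realType}.
Local Notation mu := (@lebesgue_measure R).
Implicit Types (f df : R -> R) (a b x : R).

Lemma is_derive_unique f x a b : is_derive x 1 f a -> is_derive x 1 f b -> a = b.
Proof. by move=> [_ <-] [_ <-]. Qed.

Lemma is_derive_within f df (i : interval R) : (forall s : R, is_derive s 1 f (df s)) ->
  {within [set` i], continuous f}.
Proof.
move=> d; apply: derivable_within_continuous => x _; by case: (d x).
Qed.

Lemma is_derive_le f df a b : (forall s : R, is_derive s 1 f (df s)) ->
  (forall x, a < x < b -> 0 <= df x) -> a <= b -> f a <= f b.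
Proof.
move=> d df0 ab; have h (x : R) : x \in `]a, b[ -> 0 <= f^`()%classic x.
  by rewrite in_itv/= derive1E => /df0; case: (d x) => _ ->.
apply: (ger0_derive1_ndecr _ h) => //; exact: is_derive_within d.
Qed.

Lemma is_derive_lt f df a b : (forall s : R, is_derive s 1 f (df s)) ->
  (forall x, a < x < b -> 0 < df x) -> a < b -> f a < f b.
Proof.
move=> d df0 ab; have h (x : R) : x \in `]a, b[ -> 0 < f^`()%classic x.
  by rewrite in_itv/= derive1E => /df0; case: (d x) => _ ->.
apply: (gtr0_derive1_incr _ h) => //; exact: is_derive_within d.
Qed.

Lemma Rintegral_is_derive f df a b : (forall s : R, is_derive s 1 f (df s)) ->
  continuous df -> a <= b -> \int[mu]_(x in `[a, b]) df x = f b - f a.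
Proof.
move=> d cdf; rewrite le_eqVlt => /predU1P[<-|ab].
  by rewrite set_itv1 Rintegral_set1 subrr.
rewrite /Rintegral (@continuous_FTC2 _ df f)//.
- exact: continuous_subspaceT.
- have cf x : {for x, continuous f} by exact: is_derive_continuous (d x).
  split=> [x _||]; first by case: (d x).
    exact: cvg_at_right_filter (cf a).
  exact: cvg_at_left_filter (cf b).
- by move=> x _; rewrite derive1E; case: (d x).
Qed.

(** From a base point a to the left of both 0 and x, the oriented integral is a
    difference of integrals over intervals that start at a. *)
Lemma is_derive_oriented_integral f x : continuous f ->
  is_derive x 1 (oriented_integral f) (f x).
Proof.
move=> cf; pose a := Num.min x 0 - 1.
have ax : a < x by rewrite ltrBlDr gt_min ltrDl ltr01.
have a0 : a < 0 by rewrite ltrBlDr add0r gt_min ltr01 orbT.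
pose G (y : R) := \int[mu]_(t in `[a, y]) f t.
have If b : mu.-integrable `[a, b] (EFin \o f).
  apply: continuous_compact_integrable; first exact: segment_compact.
  exact: continuous_subspaceT.
have [dG G'] : derivable G x 1 /\ G^`()%classic x = f x.
  by apply: (@continuous_FTC1_closed _ _ _ _ (x + 1)) => //; [rewrite ltrDl|exact: cf].
have split_int b c : a <= b -> b <= c ->
    \int[mu]_(t in `[b, c]) f t = G c - G b.
  move=> ab bc; rewrite /G (Rintegral_itvB (If c)) ?bnd_simp//.
  rewrite Rintegral_itv_obnd_cbnd//.
  have := If c; apply: integrableS => //.
  by apply: subset_itvr; rewrite bnd_simp.
have E : \near x, oriented_integral f x = G x - G 0.
  near=> y; have ay : a <= y.
    by apply: ltW; near: y; exact: lt_nbhsr.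
  rewrite /oriented_integral; have [y0|y0] := ltP y 0.
    rewrite set_itv_ge ?Rintegral_set0 -?ltNge ?bnd_simp// sub0r.
    by rewrite split_int// ?opprB//; exact: ltW.
  rewrite (split_int 0 y)//; last exact: ltW.
  move: y0; rewrite le_eqVlt => /predU1P[<-|y0].
    by rewrite set_itv1 Rintegral_set1 subr0.
  by rewrite [X in _ - X](_ : _ = 0) ?subr0// set_itv_ge ?Rintegral_set0// -ltNge.
have dG' : is_derive x 1 (fun y => G y - G 0) (f x).
  have dGx : is_derive x 1 G (f x) by apply: DeriveDef; [exact: dG|rewrite -derive1E].
  by derive_eq; [der|rewrite subr0].
apply: (near_eq_is_derive _ dG').
by apply: filterS E => y ->.
Unshelve. all: by end_near. Qed.

End RealAnalysis.

(** * The profile equation as a regular system *)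

Section Profile.
Context {R : realType}.
Variables (n : nat) (c alpha : R) (u : R -> R).
Hypothesis n1 : (1 <= n)%N.
Hypothesis c0 : 0 < c.
Hypothesis halpha : only_positive_root (catenoid_Q n c) alpha.
Hypothesis hu : catenoid_profile n c alpha u.

Let M : R := (2 * n - 1)%N%:R.
Let M0 : 0 < M. Proof. by rewrite ltr0n; lia. Qed.

Lemma catenoid_QE (x : R) :
  (catenoid_Q n c).[x] = - x ^+ (2 * n) + c ^+ 2 * x + (2 * n - 1)%N%:R ^+ 2.
Proof. by rewrite /catenoid_Q !hornerE. Qed.

Let dQ (x : R) : R := - ((2 * n)%:R * x ^+ (2 * n).-1) + c ^+ 2.

Let Q (x : R) : R := - x ^+ (2 * n) + c ^+ 2 * x + M ^+ 2.

Let is_derive_Q (x : R) : is_derive x 1 Q (dQ x).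
Proof. by derive_eq; [rewrite /Q; der|rewrite /dQ !mulr1 addr0]. Qed.

Let u' : R -> R := derive1 u.
Let u'' : R -> R := derive1 u'.

Let u_gt0 s : 0 < u s. Proof. by case: hu => _ _ /(_ s)/andP[]. Qed.

Let du (s : R) : is_derive s 1 u (u' s).
Proof.
by case: hu => /(_ 0%N s) /= d _ _ _ _; rewrite /u' derive1E; exact/derivableP.
Qed.

Let du' (s : R) : is_derive s 1 u' (u'' s).
Proof.
by case: hu => /(_ 1%N s) /= d _ _ _ _; rewrite /u'' derive1E; exact/derivableP.
Qed.

Let cu'' : continuous u''.
Proof.
case: hu => /(_ 2%N) /= d _ _ _ _ s.
exact/differentiable_continuous/derivable1_diffP/d.
Qed.

(** The defining equation of the profile is the conservation of energy for the
    second-order equation u'' = g(u), whose force g is defined below. *)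
Let energy s : u' s ^+ 2 = 4 / M ^+ 2 * (u s ^+ 2 * Q (u s)).
Proof. by case: hu => _ _ _ -> _; rewrite catenoid_QE -/M /Q; ring. Qed.

Let g (x : R) : R := 2 / M ^+ 2 * (2 * x * Q x + x ^+ 2 * dQ x).

Let u'_eq0 s : u' s = 0 -> u s = alpha.
Proof.
move=> e; case: halpha => _ _; apply=> //.
rewrite /root catenoid_QE -/M -/(Q (u s)).
have := energy s; rewrite e expr0n /= => /esym/eqP.
have k0 : 4 / M ^+ 2 != 0 by rewrite mulf_neq0// invr_eq0 expf_neq0// gt_eqF.
by rewrite mulf_eq0 (negbTE k0) mulf_eq0 expf_eq0 (gt_eqF (u_gt0 s)).
Qed.

Let second_order_regular s : u' s != 0 -> u'' s = g (u s).
Proof.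
move=> u'0.
have d1 : is_derive s 1 (fun s => u' s ^+ 2) (2 * u' s * u'' s).
  by derive_eq; [der|rewrite /= expr1].
have d2 : is_derive s 1 (fun s => u' s ^+ 2) (2 * u' s * g (u s)).
  have -> : (fun s => u' s ^+ 2) = (fun s => 4 / M ^+ 2 * (u s ^+ 2 * Q (u s))).
    by apply/funext => t; exact: energy.
  have dQ' := is_derive_Q; derive_eq; first by der.
  by rewrite /g /= expr1; field; rewrite gt_eqF.
have := is_derive_unique d1 d2; apply: mulfI.
by rewrite mulf_neq0.
Qed.

Let h s := u'' s - g (u s).

Let ch : continuous h.
Proof.
move=> s; apply: cvgB; first exact: cu''.
apply: (@continuous_comp _ _ _ u g); first exact: is_derive_continuous (du s).
suff : exists d : R, is_derive (u s) 1 g d by case=> d; exact: is_derive_continuous.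
have dQ' := is_derive_Q; eexists; rewrite /g /dQ.
by der.
Qed.

(** Where the defect is nonzero, u' vanishes in a neighbourhood, hence so does
    u'', and u equals alpha. *)
Let h_value s : h s != 0 -> h s = - g alpha.
Proof.
move=> hs; have near0 : \near s, u' s = 0.
  have : \near s, h s != 0.
    have /= := @ch s; move/cvgr_neq0; exact.
  apply: filterS => t; apply: contraNeq => /second_order_regular.
  by rewrite /h => ->; rewrite subrr.
have u'0 : u' s = 0 by exact: nbhs_singleton near0.
rewrite /h (u'_eq0 u'0) (_ : u'' s = 0) ?sub0r//.
apply: (@is_derive_unique _ u' s) => //.
have near0' : \near s, cst 0 s = u' s by apply: filterS near0 => t ->.
exact: near_eq_is_derive near0' (is_derive_cst _ _ _).
Qed.

(** The equation squares u', so it determines u'' only where u' <> 0. The defect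
    h = u'' - g(u) is continuous and takes at most the values 0 and - g(alpha),
    so it is constant, and it cannot be nonzero since u would then be constant. *)
Lemma profile_second_order s : u'' s = g (u s).
Proof.
apply/eqP; rewrite -subr_eq0 -/(h s); apply/negP => /negP hs.
have hall t : h t != 0.
  apply/negP => /eqP ht.
  have k0 : h s / 2 != h s.
    by apply/negP => /eqP e; case/negP: hs; apply/eqP; lra.
  have k1 : h s / 2 != 0 by rewrite mulf_neq0// invr_eq0 pnatr_eq0.
  (* On the way from h s to 0 the continuous h takes the excluded value h s / 2. *)
  have [r _ hr] : exists2 r, r \in `[Num.min s t, Num.max s t] & h r = h s / 2.
    apply: IVT; first by rewrite ge_min le_max lexx.
      exact: continuous_subspaceT ch.
    have H (a b : R) : (a = h s /\ b = 0) \/ (a = 0 /\ b = h s) ->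
        Num.min a b <= h s / 2 <= Num.max a b.
      have [hs0|hs0] : 0 <= h s \/ h s <= 0 by apply/orP; exact: le_total.
        by move=> [|] [-> ->]; rewrite ge_min le_max;
          apply/andP; split; apply/orP; first [by left; lra|by right; lra].
      by move=> [|] [-> ->]; rewrite ge_min le_max;
        apply/andP; split; apply/orP; first [by left; lra|by right; lra].
    by apply: H; have [st|st] := leP s t; [left|right].
  move: k0; rewrite -hr h_value ?hr// => /negP; apply.
  by rewrite -(h_value hs).
have u'0 t : u' t = 0.
  apply/eqP; move: (hall t); apply: contraNT => /second_order_regular.
  by rewrite /h => ->; rewrite subrr.
case: hu => _ + _ _ _; apply; exists alpha => t; exact: u'_eq0.
Qed.

Lemma profile_gt0 s : 0 < u s. Proof. exact: u_gt0. Qed.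

Definition profile_y s : R := Num.sqrt (u s).

(** A square root of Q(u) / u that depends smoothly on s, through u' = 0; its
    sign makes it increasing. *)
Definition profile_T s : R := - (M / 2) * (u' s / (u s * Num.sqrt (u s))).

Let y_gt0 s : 0 < profile_y s. Proof. by rewrite sqrtr_gt0. Qed.
Let y2 s : profile_y s ^+ 2 = u s. Proof. by rewrite sqr_sqrtr// ltW. Qed.

Lemma is_derive_profile_y (s : R) :
  is_derive s 1 profile_y (- (profile_y s ^+ 2 * profile_T s) / M).
Proof.
derive_eq; first by rewrite /profile_y; der; exact: u_gt0.
rewrite -/(profile_y s) y2 /profile_T -/(profile_y s).
by field; rewrite !gt_eqF ?y_gt0 ?u_gt0 ?M0.
Qed.

Lemma profile_u' s : u' s = - (2 / M) * (profile_y s ^+ 3 * profile_T s).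
Proof.
rewrite /profile_T -/(profile_y s) -(y2 s); have := y_gt0 s.
by move: (profile_y s) => Y Y0; field; rewrite !gt_eqF ?M0.
Qed.

Lemma profile_Q s : Q (u s) = profile_y s ^+ 2 * profile_T s ^+ 2.
Proof.
have := energy s; rewrite profile_u' -{1}(y2 s).
rewrite (_ : _ ^+ 2 = 4 / M ^+ 2 *
    ((profile_y s ^+ 2) ^+ 2 * (profile_y s ^+ 2 * profile_T s ^+ 2))).
  have k0 : 4 / M ^+ 2 != 0 by rewrite mulf_neq0// invr_eq0 expf_neq0// gt_eqF.
  by move=> /(mulfI k0) /mulfI <- //; rewrite !expf_neq0// gt_eqF ?y_gt0.
by field; rewrite gt_eqF.
Qed.

Lemma is_derive_profile_T (s : R) :
  is_derive s 1 profile_T ((M + profile_y s ^+ (4 * n)) / profile_y s).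
Proof.
have yN0 : profile_y s != 0 by rewrite gt_eqF ?y_gt0.
have dy := is_derive_profile_y.
derive_eq.
  rewrite /profile_T -/(profile_y); der.
  by rewrite mulf_neq0// gt_eqF.
rewrite /= -/(profile_y s).
have -> : u'' s = g (u s) by exact: profile_second_order.
have MN0 : M != 0 by rewrite gt_eqF.
have eu : u s = profile_y s ^+ 2 by rewrite y2.
have eT := profile_u' s.
have eQ : Q (u s) = profile_y s ^+ 2 * profile_T s ^+ 2 by exact: profile_Q.
have eW : u s * dQ (u s) = Q (u s) - M ^+ 2 - M * profile_y s ^+ (4 * n).
  have e2n : u s ^+ (2 * n) = u s * u s ^+ (2 * n).-1.
    by rewrite -exprS prednK//; lia.
  have -> : profile_y s ^+ (4 * n) = u s ^+ (2 * n).
    by rewrite eu -exprM; congr (_ ^+ _); lia.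
  have eM : M = (2 * n)%:R - 1 by rewrite /M natrB//; lia.
  by rewrite /dQ /Q e2n eM; ring.
have -> : g (u s) = 2 * profile_y s ^+ 2 / M ^+ 2 *
    (3 * (profile_y s ^+ 2 * profile_T s ^+ 2) - M ^+ 2 - M * profile_y s ^+ (4 * n)).
  rewrite /g (_ : u s ^+ 2 * dQ (u s) = u s * (u s * dQ (u s))); last by ring.
  by rewrite eW eQ eu; ring.
rewrite eT eu.
move: (profile_y s) (profile_T s) (profile_y s ^+ (4 * n)) yN0 => Y t W Y0.
by field; rewrite MN0 Y0.
Qed.

Lemma profile_T0 : profile_T 0 = 0.
Proof.
have e0 : u 0 = alpha by case: hu.
have u'0 : u' 0 = 0.
  apply/eqP; rewrite -sqrf_eq0 energy /Q e0 -catenoid_QE.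
  by case: halpha => _ /rootP -> _; rewrite !mulr0.
by rewrite /profile_T u'0 mul0r mulr0.
Qed.

Lemma is_derive_catenoid_v (s : R) : is_derive s 1 (catenoid_v n c u)
  (- (c * profile_y s ^+ (2 * n).+1 / (c ^+ 2 * profile_y s ^+ 2 + M ^+ 2))).
Proof.
pose f s := profile_y s ^+ (2 * n).+1 / (c ^+ 2 * profile_y s ^+ 2 + M ^+ 2).
have D0 t : c ^+ 2 * profile_y t ^+ 2 + M ^+ 2 != 0.
  by rewrite gt_eqF// ltr_wpDl ?exprn_gt0// mulr_ge0// sqr_ge0.
have cf : continuous f.
  move=> t; have dy := is_derive_profile_y.
  suff [d /is_derive_continuous//] : exists d, is_derive t 1 f d.
  by eexists; rewrite /f; der.
have -> : catenoid_v n c u = fun s => - c * oriented_integral f s.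
  apply/funext => t; rewrite /catenoid_v; congr (_ * oriented_integral _ t).
  apply/funext => x; rewrite /f y2; congr (_ / _).
  rewrite powRD ?gt_eqF ?u_gt0 ?implybT// powR_mulrn ?(ltW (u_gt0 _))//.
  rewrite div1r powR12_sqrt ?(ltW (u_gt0 _))// -/(profile_y x) -{1}(y2 x).
  by rewrite -exprM -exprSr.
have dF := is_derive_oriented_integral s cf.
by derive_eq; [der|rewrite /f mulNr mulrA].
Qed.

Lemma catenoid_v0 : catenoid_v n c u 0 = 0.
Proof. by rewrite /catenoid_v /oriented_integral subrr mulr0. Qed.

End Profile.

(** * Asymptotics along an end *)

Section Limits.
Context {R : realType}.
Implicit Types (f : R -> R) (s x : R).

Lemma ndecr_bounded_cvg f s0 (B : R) :
  (forall x y, s0 <= x -> x <= y -> f x <= f y) -> (forall x, s0 <= x -> f x <= B) ->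
  exists l : R, f x @[x --> +oo] --> l.
Proof.
move=> fm fB; pose g x := f (Num.max x s0).
have gm : {homo g : x y / x <= y}.
  move=> x y xy; apply: fm; first by rewrite le_max lexx orbT.
  by rewrite ge_max !le_max xy lexx !orbT.
have gB : has_ubound (range g).
  by exists B => _ [x _ <-]; apply: fB; rewrite le_max lexx orbT.
exists (sup (range g)); have := nondecreasing_cvgr gm gB.
apply: cvg_trans; apply: near_eq_cvg; near=> x.
rewrite /g max_l//; near: x; exact: nbhs_pinfty_ge.
Unshelve. all: by end_near. Qed.

Lemma cvgy_le f s0 (l : R) : f x @[x --> +oo] --> l ->
  (forall x y, s0 <= x -> x <= y -> f x <= f y) -> forall x, s0 <= x -> f x <= l.
Proof.
move=> fl fm x xs; apply: (cvgr_to_ge fl).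
by near=> y; apply: fm => //; near: y; exact: nbhs_pinfty_ge.
Unshelve. all: by end_near. Qed.

End Limits.

Section Cosh.
Context {R : realType}.

Lemma is_derive_cosh (x : R) : is_derive x 1 (@cosh R) (sinh x).
Proof.
derive_eq; first by rewrite /cosh; der.
by rewrite /sinh /=; ring.
Qed.

Lemma is_derive_sinh (x : R) : is_derive x 1 (@sinh R) (cosh x).
Proof.
derive_eq; first by rewrite /sinh; der.
by rewrite /cosh /=; ring.
Qed.

Lemma cosh_gt0 (x : R) : 0 < cosh x.
Proof. by rewrite divr_gt0// addr_gt0// expR_gt0. Qed.

Lemma coshN (x : R) : cosh (- x) = cosh x.
Proof. by rewrite /cosh opprK addrC. Qed.

Lemma sinh_le0 (x : R) : x <= 0 -> sinh x <= 0.
Proof.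
by move=> x0; rewrite /sinh pmulr_lle0// subr_le0 ler_expR; lra.
Qed.

Lemma cosh2_sinh2 (x : R) : cosh x ^+ 2 - sinh x ^+ 2 = 1.
Proof.
rewrite /cosh /sinh expRN; have := expR_gt0 x; move: (expR x) => e e0.
by field; rewrite gt_eqF.
Qed.

End Cosh.

Section System.
Context {R : realType}.
Local Notation mu := (@lebesgue_measure R).

(** The system is stated for arbitrary functions, since the two halves of the
    catenoid satisfy it with the parameter reversed. *)
Record catenoid_system (n : nat) (c : R) (y T v : R -> R) : Prop := CatenoidSystem {
  sys_y_gt0 : forall s, 0 < y s;
  sys_dy : forall s : R, is_derive s 1 y (- (y s ^+ 2 * T s) / (2 * n - 1)%N%:R);
  sys_dT : forall s : R,
    is_derive s 1 T (((2 * n - 1)%N%:R + y s ^+ (4 * n)) / y s);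
  sys_yT : forall s, y s ^+ 2 * T s ^+ 2 =
    c ^+ 2 * y s ^+ 2 + (2 * n - 1)%N%:R ^+ 2 - y s ^+ (4 * n);
  sys_T0 : T 0 = 0;
  sys_dv : forall s : R, is_derive s 1 v
    (- (c * y s ^+ (2 * n).+1 / (c ^+ 2 * y s ^+ 2 + (2 * n - 1)%N%:R ^+ 2)));
  sys_v0 : v 0 = 0 }.

Variables (n : nat) (c : R) (y T v : R -> R).
Hypothesis n1 : (1 <= n)%N.
Hypothesis c0 : 0 < c.
Hypothesis sys : catenoid_system n c y T v.

Let M : R := (2 * n - 1)%N%:R.
Let M0 : 0 < M. Proof. by rewrite ltr0n; lia. Qed.
Let y_gt0 := sys_y_gt0 sys.
Let y_ge0 s : 0 <= y s. Proof. exact: ltW (y_gt0 s). Qed.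
Let c_ge0 : 0 <= c. Proof. exact: ltW c0. Qed.
Let M_ge0 : 0 <= M. Proof. exact: ltW M0. Qed.
Let dy := sys_dy sys.
Let dT := sys_dT sys.
Let yT := sys_yT sys.
Let dv := sys_dv sys.
Let D s := c ^+ 2 * y s ^+ 2 + M ^+ 2.
Let D_gt0 s : 0 < D s.
Proof. by rewrite ltr_wpDl ?exprn_gt0// mulr_ge0// sqr_ge0. Qed.

Lemma sys_T_gt0 s : 0 < s -> 0 < T s.
Proof.
move=> s0; rewrite -(sys_T0 sys); apply: is_derive_lt dT _ s0 => x _.
by rewrite divr_gt0// addr_gt0// exprn_gt0.
Qed.

Lemma sys_y_lt s t : 0 <= s -> s < t -> y t < y s.
Proof.
move=> s0 st; rewrite -ltrN2.
have dNy (x : R) : is_derive x 1 (fun s => - y s) (y x ^+ 2 * T x / M).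
  by derive_eq; [der|rewrite mulNr opprK].
apply: is_derive_lt dNy _ st => x /andP[sx _].
by rewrite divr_gt0// mulr_gt0 ?exprn_gt0// sys_T_gt0// (le_lt_trans s0).
Qed.

Lemma sys_y_le s t : 0 <= s -> s <= t -> y t <= y s.
Proof.
by move=> s0; rewrite le_eqVlt => /predU1P[->//|] /(sys_y_lt s0)/ltW.
Qed.

Lemma sys_T_ge s : 0 <= s -> M / y 0 * s <= T s.
Proof.
move=> s0; rewrite -subr_ge0.
have d (x : R) : is_derive x 1 (fun s => T s - M / y 0 * s)
    ((M + y x ^+ (4 * n)) / y x - M / y 0).
  by derive_eq; [der|rewrite mulr1].
have := is_derive_le d _ s0; rewrite (sys_T0 sys) mulr0 subr0; apply.
move=> x /andP[/ltW x0 _]; rewrite subr_ge0.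
rewrite ler_pM ?invr_ge0 ?(ltW (y_gt0 _)) ?(ltW M0)//.
  by rewrite lerDl exprn_ge0// ltW.
by rewrite lef_pV2 ?posrE//; exact: sys_y_le.
Qed.

Let K : R := c * y 0 + M.

Let yT_le s : 0 <= s -> y s * T s <= K.
Proof.
move=> s0; have K0 : 0 <= K by rewrite addr_ge0 ?mulr_ge0 ?y_ge0 ?c_ge0 ?M_ge0.
have [yT0|/ltW yT0] := leP (y s * T s) 0; first exact: le_trans yT0 K0.
rewrite -(ler_pXn2r (n := 2)) ?nnegrE// exprMn yT.
have h1 : y s <= y 0 by exact: sys_y_le.
have h2 : y s ^+ 2 <= y 0 ^+ 2 by rewrite ler_pXn2r ?nnegrE ?y_ge0.
have h3 : 0 <= y s ^+ (4 * n) by rewrite exprn_ge0 ?y_ge0.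
have h4 : c ^+ 2 * y s ^+ 2 <= c ^+ 2 * y 0 ^+ 2 by rewrite ler_wpM2l ?sqr_ge0.
have h5 : 0 <= c * y 0 * M by rewrite !mulr_ge0 ?y_ge0 ?c_ge0 ?M_ge0.
rewrite (_ : K ^+ 2 = c ^+ 2 * y 0 ^+ 2 + M ^+ 2 + 2 * (c * y 0 * M)); last first.
  by rewrite /K; ring.
rewrite -/M; lra.
Qed.

(** The product y T stays bounded while T grows at least linearly. *)
Lemma sys_y_cvg0 : y s @[s --> +oo] --> 0.
Proof.
have K0 : 0 < K by rewrite addr_gt0 ?mulr_gt0.
apply: (squeeze_cvgr (f := fun=> 0) (h := fun s => K * y 0 / M * s^-1)).
- near=> s; have s0 : 0 < s by near: s; exact: nbhs_pinfty_gt.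
  rewrite ltW//= ler_pdivlMr// mulrC.
  have T0 := sys_T_gt0 s0.
  have h1 := sys_T_ge (ltW s0); have h2 := yT_le (ltW s0).
  have h3 : y s * (M / y 0 * s) <= K.
    by apply: le_trans h2; rewrite ler_wpM2l// ltW.
  have -> : s * y s = (y s * (M / y 0 * s)) * (y 0 / M) by field; rewrite !gt_eqF.
  by rewrite -[leRHS]mulrA ler_wpM2r// divr_ge0.
- exact: cvg_cst.
- rewrite -[X in _ --> X](mulr0 (K * y 0 / M)).
  apply: cvgM; first exact: cvg_cst.
  by apply/gtr0_cvgV0; [exact: nbhs_pinfty_gt|exact: cvg_id].
Unshelve. all: by end_near. Qed.

Lemma cvg_sys_y k : (0 < k)%N -> y s ^+ k @[s --> +oo] --> 0.
Proof.
by move=> k0; have := cvgX_fun (k := k) sys_y_cvg0; rewrite expr0n (gtn_eqF k0); exact.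
Qed.

Let yTE s : 0 <= s -> y s * T s = Num.sqrt (D s - y s ^+ (4 * n)).
Proof.
move=> s0; rewrite /D -yT -exprMn sqrtr_sqr ger0_norm// mulr_ge0//.
move: s0; rewrite le_eqVlt => /predU1P[<-|/sys_T_gt0/ltW//].
by rewrite (sys_T0 sys).
Qed.

Lemma cvg_sys_D : D s @[s --> +oo] --> M ^+ 2.
Proof.
rewrite -[X in _ --> X]add0r; apply: cvgD; last exact: cvg_cst.
rewrite -(mulr0 (c ^+ 2)); apply: cvgM; first exact: cvg_cst.
exact: cvg_sys_y.
Qed.

Lemma cvg_sys_sqrtD : Num.sqrt (D s) @[s --> +oo] --> M.
Proof.
have -> : M = Num.sqrt (M ^+ 2) by rewrite sqrtr_sqr ger0_norm// ltW.
by apply: continuous_cvg; [exact: sqrt_continuous|exact: cvg_sys_D].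
Qed.

Lemma cvg_sys_yT : y s * T s @[s --> +oo] --> M.
Proof.
have : Num.sqrt (D s - y s ^+ (4 * n)) @[s --> +oo] --> M.
  have -> : M = Num.sqrt (M ^+ 2 - 0).
    by rewrite subr0 sqrtr_sqr ger0_norm// ltW.
  apply: continuous_cvg; first exact: sqrt_continuous.
  by apply: cvgB; [exact: cvg_sys_D|apply: cvg_sys_y; lia].
apply: cvg_trans; apply: near_eq_cvg; near=> s; by rewrite yTE.
Unshelve. all: by end_near. Qed.

Lemma sys_v_le s t : s <= t -> v t <= v s.
Proof.
move=> st; rewrite -lerN2.
have dNv (x : R) : is_derive x 1 (fun s => - v s) (c * y x ^+ (2 * n).+1 / D x).
  by derive_eq; [der|rewrite opprK].
apply: is_derive_le dNv _ st => x _.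
by rewrite divr_ge0 ?mulr_ge0 ?exprn_ge0 ?y_ge0 ?c_ge0// ltW// D_gt0.
Qed.

Let K5 : R := 2 * c / (M ^+ 2 * (2 * n).+1%:R).

(** Along the end, y T tends to M, so y' is about - y, while - v' is at most
    (c / M^2) y^(2n+1). The constant K5 is chosen so that y T >= M / 2 already
    makes v - K5 y^(2n+1) increase; this bounds v from below and, later, its
    distance to the limit. *)
Let W_ndecr : exists2 s0, 0 <= s0 & forall s t, s0 <= s -> s <= t ->
  v s - K5 * y s ^+ (2 * n).+1 <= v t - K5 * y t ^+ (2 * n).+1.
Proof.
have : \forall s \near +oo, M / 2 <= y s * T s.
  have := cvg_sys_yT; move/cvgr_ge; apply.
  by rewrite ltr_pdivrMr// ltr_pMr// ltr1n.
move=> [s0 [_ hs0]]; exists (Num.max 0 (s0 + 1)); first by rewrite le_max lexx.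
move=> s t; rewrite ge_max => /andP[s_ge0 s0s] st.
have d (x : R) : is_derive x 1 (fun s => v s - K5 * y s ^+ (2 * n).+1)
    (- (c * y x ^+ (2 * n).+1 / D x) +
     K5 * (2 * n).+1%:R * y x ^+ (2 * n).+1 * (y x * T x) / M).
  derive_eq; first by der.
  by rewrite exprS /=; ring.
apply: is_derive_le d _ st => x /andP[sx _].
have hx : M / 2 <= y x * T x.
  by apply: hs0; rewrite (lt_trans _ sx)// (lt_le_trans _ s0s)// ltrDl.
have Y0 : 0 < y x ^+ (2 * n).+1 by rewrite exprn_gt0.
have h1 : c * y x ^+ (2 * n).+1 / D x <= c * y x ^+ (2 * n).+1 / M ^+ 2.
  rewrite ler_wpM2l ?mulr_ge0 ?exprn_ge0 ?y_ge0 ?c_ge0// lef_pV2 ?posrE ?exprn_gt0//.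
  by rewrite lerDr mulr_ge0 ?sqr_ge0.
have N0 : (2 * n).+1%:R != 0 :> R by rewrite pnatr_eq0.
have -> : K5 * (2 * n).+1%:R * y x ^+ (2 * n).+1 * (y x * T x) / M =
    (2 * c * y x ^+ (2 * n).+1 / M ^+ 3) * (y x * T x).
  by rewrite /K5; move: ((2 * n).+1%:R) N0 => N N0; field; rewrite N0 gt_eqF.
have h2 : c * y x ^+ (2 * n).+1 / M ^+ 2 =
    (2 * c * y x ^+ (2 * n).+1 / M ^+ 3) * (M / 2).
  by field; rewrite gt_eqF.
have h3 : (2 * c * y x ^+ (2 * n).+1 / M ^+ 3) * (M / 2) <=
    (2 * c * y x ^+ (2 * n).+1 / M ^+ 3) * (y x * T x).
  by rewrite ler_wpM2l// divr_ge0 ?mulr_ge0 ?exprn_ge0 ?y_ge0 ?c_ge0 ?M_ge0.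
by lra.
Qed.

Let v_cvg : exists l : R, v s @[s --> +oo] --> l.
Proof.
have [s0 s0_ge0 W] := W_ndecr.
have K50 : 0 <= K5 by rewrite divr_ge0 ?mulr_ge0 ?exprn_ge0 ?y_ge0 ?c_ge0 ?M_ge0.
have [l vl] : exists l : R, - v x @[x --> +oo] --> l.
  apply: (@ndecr_bounded_cvg _ _ s0 (- (v s0 - K5 * y s0 ^+ (2 * n).+1))).
    by move=> x z _ xz; rewrite lerN2; exact: sys_v_le.
  move=> x s0x; rewrite lerN2; have := W _ _ (lexx s0) s0x => /le_trans; apply.
  by rewrite gerBl mulr_ge0 ?exprn_ge0 ?y_ge0.
exists (- l); have : - - v x @[x --> +oo] --> - l by exact: cvgN.
by under eq_fun do rewrite opprK.
Qed.

Lemma sys_v_limit : exists vinf, [/\ v s @[s --> +oo] --> vinf,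
  forall s, vinf <= v s &
  exists2 s0, 0 <= s0 & forall s, s0 <= s -> v s - vinf <= K5 * y s ^+ (2 * n).+1].
Proof.
have [l vl] := v_cvg; have [s0 s0_ge0 W] := W_ndecr; exists l; split=> //.
  move=> s; apply: (cvgr_to_le vl); near=> t; apply: sys_v_le.
  by near: t; exact: nbhs_pinfty_ge (num_real s).
exists s0 => // s s0s; rewrite lerBlDr -lerBlDl.
have Wl : v s - K5 * y s ^+ (2 * n).+1 @[s --> +oo] --> l.
  rewrite -[X in _ --> X]subr0 -(mulr0 K5); apply: cvgB => //.
  by apply: cvgM; [exact: cvg_cst|exact: cvg_sys_y].
by apply: (cvgy_le Wl W).
Unshelve. all: by end_near. Qed.

(** Since v is within a multiple of y^(2n+1) of its limit and cosh is Lipschitz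
    on the range of v, the same holds for cosh v. *)
Lemma sys_cosh_limit : exists2 C, 0 < C &
  (C - cosh (v s)) / y s ^+ (2 * n) @[s --> +oo] --> 0.
Proof.
have [l [vl lv [s0 s0_ge0 hv]]] := sys_v_limit.
have l0 : l <= 0 by rewrite -(sys_v0 sys).
exists (cosh l); first exact: cosh_gt0.
pose L := cosh l.
have sinhL x : l <= x -> x <= 0 -> - L <= sinh x.
  move=> lx x0; rewrite lerNl.
  have : - sinh x <= cosh x by have := expR_gt0 x; rewrite /sinh /cosh; lra.
  move/le_trans; apply; rewrite /L -lerN2.
  have d (r : R) : is_derive r 1 (fun x => - cosh x) (- sinh r).
    by have dc := is_derive_cosh; der.
  apply: is_derive_le d _ lx => z /andP[_ zx].
  by rewrite oppr_ge0 sinh_le0// ltW// (lt_le_trans zx).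
have bound x : l <= x -> x <= 0 -> 0 <= cosh l - cosh x <= L * (x - l).
  move=> lx x0; apply/andP; split.
    have d (r : R) : is_derive r 1 (fun x => - cosh x) (- sinh r).
      by have dc := is_derive_cosh; der.
    have := is_derive_le d _ lx; rewrite lerN2 subr_ge0; apply=> z /andP[_ zx].
    by rewrite oppr_ge0 sinh_le0// ltW// (lt_le_trans zx).
  have d (r : R) : is_derive r 1 (fun x => cosh x + L * x) (sinh r + L).
    by have dc := is_derive_cosh; derive_eq; [der|rewrite mulr1].
  have := is_derive_le d _ lx => H.
  have : cosh l + L * l <= cosh x + L * x.
    apply: H => z /andP[lz zx]; rewrite -lerBlDr sub0r sinhL// ltW//.
    exact: lt_le_trans zx x0.
  by rewrite mulrBr; lra.
apply: (squeeze_cvgr (f := fun=> 0) (h := fun s => L * K5 * y s)).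
- near=> s; have ss0 : s0 <= s by near: s; exact: nbhs_pinfty_ge (num_real s0).
  have vs0 : v s <= 0 by rewrite -(sys_v0 sys); apply: sys_v_le; exact: le_trans ss0.
  have /andP[b1 b2] := bound _ (lv s) vs0.
  have Y0 : 0 < y s ^+ (2 * n) by rewrite exprn_gt0.
  rewrite divr_ge0 ?(ltW Y0)//= ler_pdivrMr// (le_trans b2)//.
  have -> : L * K5 * y s * y s ^+ (2 * n) = L * (K5 * y s ^+ (2 * n).+1).
    by rewrite exprS; ring.
  by apply: ler_wpM2l; [exact: ltW (cosh_gt0 _)|exact: hv].
- exact: cvg_cst.
- rewrite -[X in _ --> X](mulr0 (L * K5)).
  by apply: cvgM; [exact: cvg_cst|exact: sys_y_cvg0].
Unshelve. all: by end_near. Qed.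

(** The height coordinate of the generating curve. *)
Definition sys_z s : R := (c * y s)^-1 * (Num.sqrt (D s) * cosh (v s)).

(** Put r = sqrt (c^2 y^2 + M^2), so that c y z = r cosh v. Then r^2 - (y T)^2 is
    y^(4n), so y T differs from r by O(y^(4n)), and r differs from c y z / C by
    O(C - cosh v). *)
Lemma sys_T_sub_z C : 0 < C ->
  (C - cosh (v s)) / y s ^+ (2 * n) @[s --> +oo] --> 0 ->
  (y s * T s - y s * (c / C * sys_z s)) / y s ^+ (2 * n) @[s --> +oo] --> 0.
Proof.
move=> C0 hC.
pose r s := Num.sqrt (D s).
have : - (y s ^+ (2 * n) / (r s + y s * T s)) +
   r s / C * ((C - cosh (v s)) / y s ^+ (2 * n)) @[s --> +oo] --> 0.
  have -> : (0 : R) = - (0 / (M + M)) + M / C * 0 by rewrite mul0r mulr0 oppr0 addr0.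
  have MM : M + M != 0 by rewrite gt_eqF// addr_gt0.
  apply: cvgD; [apply: cvgN|apply: cvgM => //]; apply: cvgM.
  - by apply: cvg_sys_y; lia.
  - by apply: cvgV => //; apply: cvgD; [exact: cvg_sys_sqrtD|exact: cvg_sys_yT].
  - exact: cvg_sys_sqrtD.
  - exact: cvg_cst.
apply: cvg_trans; apply: near_eq_cvg; near=> s.
have s0 : 0 < s by near: s; exact: nbhs_pinfty_gt.
have T0 := sys_T_gt0 s0; have Y0 := y_gt0 s.
have r0 : 0 < r s by rewrite sqrtr_gt0 D_gt0.
have r2 : r s ^+ 2 = D s by rewrite sqr_sqrtr// ltW// D_gt0.
have N0 : r s + y s * T s != 0 by rewrite gt_eqF// addr_gt0// mulr_gt0.
have e1 : (r s - y s * T s) * (r s + y s * T s) = y s ^+ (2 * n) ^+ 2.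
  by rewrite -subr_sqr r2 exprMn yT /D -/M -exprM mulnAC; ring.
have P0 : y s ^+ (2 * n) != 0 by rewrite gt_eqF// exprn_gt0.
have -> : y s ^+ (2 * n) / (r s + y s * T s) = (r s - y s * T s) / y s ^+ (2 * n).
  apply: (mulIf N0); rewrite divfK// mulrAC e1 expr2 mulfK//.
rewrite /sys_z -/(r s); move: (y s ^+ (2 * n)) P0 => P P0.
by field; rewrite P0 !gt_eqF.
Unshelve. all: by end_near. Qed.

(** Both T and c z / C have the size of 1/y and differ by o(y^(2n-1)). Hence
    their k-th powers differ by o(y^(2n-k)), which tends to 0 for k <= 2n. *)
Lemma sys_poly_T_z C (p : {poly R}) : 0 < C ->
  (C - cosh (v s)) / y s ^+ (2 * n) @[s --> +oo] --> 0 ->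
  (size p <= (2 * n).+1)%N ->
  p.[T s] - p.[c / C * sys_z s] @[s --> +oo] --> 0.
Proof.
move=> C0 hC sp; have hd := sys_T_sub_z C0 hC.
have yN0 s : y s != 0 by rewrite gt_eqF.
have hz : y s * (c / C * sys_z s) @[s --> +oo] --> M.
  have : y s * T s - y s ^+ (2 * n) *
     ((y s * T s - y s * (c / C * sys_z s)) / y s ^+ (2 * n)) @[s --> +oo] --> M.
    rewrite -[X in _ --> X]subr0 -(mulr0 0); apply: cvgB; first exact: cvg_sys_yT.
    by apply: cvgM => //; apply: cvg_sys_y; lia.
  apply: cvg_trans; apply: near_eq_cvg; near=> s.
  by rewrite mulrCA mulfV ?mulr1 ?subKr// expf_neq0.
have mono k : (k <= 2 * n)%N -> T s ^+ k - (c / C * sys_z s) ^+ k @[s --> +oo] --> 0.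
  move=> k2n.
  have : (y s ^+ (2 * n - k) * ((y s * T s - y s * (c / C * sys_z s)) / y s ^+ (2 * n))) *
     \sum_(i < k) (y s * T s) ^+ (k.-1 - i) * (y s * (c / C * sys_z s)) ^+ i @[s --> +oo] -->
     1 ^+ (2 * n - k) * 0 * \sum_(i < k) M ^+ (k.-1 - i) * M ^+ i.
    apply: cvgM.
      rewrite mulr0; move: k2n; rewrite leq_eqVlt => /predU1P[->|k2n].
        by rewrite subnn; under eq_fun do rewrite expr0 mul1r.
      by rewrite -(mulr0 0); apply: cvgM => //; apply: cvg_sys_y; rewrite subn_gt0.
    apply: cvg_sum_fun => i.
    by apply: cvgM; apply: cvgX_fun; [exact: cvg_sys_yT|exact: hz].
  rewrite mulr0 mul0r; apply: cvg_trans; apply: near_eq_cvg; near=> s.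
  move: (c / C * sys_z s) => Z.
  have e := subrXX (y s * T s) (y s * Z) k.
  rewrite [(y s * T s) ^+ k]exprMn [(y s * Z) ^+ k]exprMn -mulrBr in e.
  have P1 := expf_neq0 k (yN0 s); have P2 := expf_neq0 (2 * n - k) (yN0 s).
  rewrite (_ : y s ^+ (2 * n) = y s ^+ (2 * n - k) * y s ^+ k); last by rewrite -exprD subnK.
  apply: (mulfI P1); rewrite e.
  move: (\sum_(i < k) _) (y s ^+ k) (y s ^+ (2 * n - k)) P1 P2 => Sg Pk Pd Pk0 Pd0.
  by field; rewrite Pk0 Pd0.
have : \sum_(i < size p) p`_i * (T s ^+ i - (c / C * sys_z s) ^+ i) @[s --> +oo] -->
    \sum_(i < size p) p`_i * 0.
  apply: cvg_sum_fun => i; apply: cvgM; first exact: cvg_cst.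
  by apply: mono; rewrite -ltnS; exact: leq_trans sp.
rewrite big1 => [|i _]; last by rewrite mulr0.
apply: cvg_trans; apply: near_eq_cvg; near=> s.
rewrite !horner_coef -sumrB; apply: eq_bigr => i _.
by rewrite mulrBr.
Unshelve. all: by end_near. Qed.

End System.

(** * Change of variables to the half-line *)

Section Substitution.
Context {R : realType}.
Local Notation mu := (@lebesgue_measure R).
Variables (phi phi' : R -> R) (alpha : R).
Hypothesis dphi : forall s : R, is_derive s 1 phi (phi' s).
Hypothesis cphi' : continuous phi'.
Hypothesis phi_decr : forall s t, 0 <= s -> s < t -> phi t < phi s.
Hypothesis phi0 : phi 0 = alpha.
Hypothesis phi_gt0 : forall s, 0 < phi s.
Hypothesis phi_cvg : phi s @[s --> +oo] --> 0.

Let phi_le s t : 0 <= s -> s <= t -> phi t <= phi s.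
Proof.
by move=> s0; rewrite le_eqVlt => /predU1P[->//|] /(phi_decr s0)/ltW.
Qed.

Let phi_derive1 : phi^`()%classic = phi'.
Proof. by apply/funext => s; rewrite derive1E; case: (dphi s). Qed.

Let cphi : continuous phi.
Proof. by move=> s; exact: is_derive_continuous (dphi s). Qed.

Lemma phi_surj x : 0 < x < alpha -> exists2 s, 0 < s & phi s = x.
Proof.
move=> /andP[x0 xa].
have [t [t0 tx]] : exists t, 0 < t /\ phi t < x.
  have h1 : \forall s \near +oo, phi s < x by move/cvgr_lt: phi_cvg; exact.
  have [t [h2 h3]] := filter_ex (filterI h1 (nbhs_pinfty_gt (num_real (0 : R)))).
  by exists t.
have [s] : exists2 s, s \in `[0, t] & phi s = x.
  apply: IVT; [exact: ltW|exact: continuous_subspaceT cphi|].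
  by rewrite phi0 ge_min le_max (ltW tx) (ltW xa) !orbT.
rewrite in_itv/= => /andP[s0 _] sx; exists s => //.
rewrite lt_neqAle s0 andbT; apply: contraTneq xa => e.
by rewrite -sx -e phi0 ltxx.
Qed.

Let J (m : nat) : set R := `[phi m.+1%:R, phi m.+1%:R^-1]%classic.

Let J_ge0 m : 0 < (m.+1%:R : R)^-1. Proof. by rewrite invr_gt0. Qed.

Let J_le m : (m.+1%:R : R)^-1 <= m.+1%:R.
Proof. by rewrite (@le_trans _ _ 1)// ?invf_le1// ler1n. Qed.

Let J_ndecr : {homo J : p q / (p <= q)%N >-> (p <= q)%O}.
Proof.
move=> p q pq; rewrite subsetEset /J => x /=; rewrite !in_itv/= => /andP[h1 h2].
apply/andP; split.
  by apply: le_trans h1; apply: phi_le => //; rewrite ler_nat.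
apply: le_trans h2 _; apply: phi_le; first by rewrite ltW.
by rewrite lef_pV2 ?posrE// ler_nat.
Qed.

Let J_bigcup : \bigcup_m J m = `]0, alpha[%classic.
Proof.
apply/seteqP; split=> [x [m _]|x].
  rewrite /J /= !in_itv/= => /andP[h1 h2]; rewrite (lt_le_trans _ h1)//=.
  by rewrite (le_lt_trans h2)// -phi0 phi_decr.
rewrite /= in_itv/= => /phi_surj[s s0 <-].
pose m := (Num.truncn (Num.max s s^-1)).
have hm : Num.max s s^-1 < m.+1%:R by rewrite truncnS_gt.
move: hm; rewrite gt_max => /andP[h1 h2].
exists m => //; rewrite /J /= in_itv/=; apply/andP; split; apply: phi_le.
- exact: ltW.
- exact: ltW.
- by rewrite ltW.
- by rewrite -[leRHS]invrK lef_pV2 ?posrE ?invr_gt0// ltW.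
Qed.

(** On the image of [1/m, m] the substitution takes place between compact
    intervals; monotone convergence removes the cut-off. This allows f to be
    singular at 0 and at alpha. *)
Lemma ge0_substitution (f k P : R -> R) (l : R) :
  {in `]0, alpha[, continuous f} -> (forall x, 0 <= f x) ->
  (forall s, 0 < s -> f (phi s) * - phi' s = k s) -> continuous k ->
  (forall s : R, is_derive s 1 P (k s)) -> P s @[s --> +oo] --> l ->
  (\int[mu]_(x in `]0%R, alpha[) (f x)%:E = (l - P 0)%:E)%E.
Proof.
move=> cf f0 fk ck dP Pl.
have mf : measurable_fun `]0, alpha[ f.
  apply: open_continuous_measurable_fun; first exact: interval_open.
  by move=> x; rewrite inE => xa; apply: cf.
have JS m : J m `<=` `]0, alpha[ by rewrite -J_bigcup; exact: bigcup_sup.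
have E m : (\int[mu]_(x in J m) (f x)%:E = (P m.+1%:R - P m.+1%:R^-1)%:E)%E.
  set a : R := m.+1%:R^-1; set b : R := m.+1%:R.
  have ab : a <= b by exact: J_le.
  have a0 : 0 < a by exact: J_ge0.
  rewrite (integration_by_substitution_decreasing ab); last first.
  - apply: continuous_in_subspaceT => x; rewrite inE => /JS; rewrite -inE.
    by move=> xJ; apply: cf; rewrite inE in xJ.
  - split; first by move=> x _; case: (dphi x).
      by apply: cvg_at_right_filter; exact: cphi.
    by apply: cvg_at_left_filter; exact: cphi.
  - by rewrite phi_derive1; apply: cvgP; exact: cvg_at_left_filter (cphi' (x := b)).
  - by rewrite phi_derive1; apply: cvgP; exact: cvg_at_right_filter (cphi' (x := a)).
  - by move=> x _; rewrite phi_derive1; exact: cphi'.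
  - move=> x z; rewrite !in_itv/= => /andP[ax _] /andP[az _] xz.
    by apply: phi_decr => //; apply: le_trans az; exact: ltW.
  rewrite -(Rintegral_is_derive dP ck ab) /Rintegral fineK; last first.
    apply: integrable_fin_num => //; apply: continuous_compact_integrable.
      exact: segment_compact.
    exact: continuous_subspaceT.
  apply: eq_integral => x; rewrite inE/= in_itv/= => /andP[ax _].
  by rewrite phi_derive1 -fk// (lt_le_trans a0).
have H1 : (\int[mu]_(x in J i) (EFin \o f) x)%E @[i --> \oo] -->
    (\int[mu]_(x in `]0%R, alpha[) (EFin \o f) x)%E.
  rewrite -J_bigcup; apply: ge0_nondecreasing_set_cvg_integral.
  - exact: J_ndecr.
  - by move=> m; exact: measurable_itv.
  - by move=> m; apply/measurable_EFinP; exact: measurable_funS (JS m) mf.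
  - by move=> m x _; rewrite lee_fin.
have H2 : (\int[mu]_(x in J i) (EFin \o f) x)%E @[i --> \oo] --> (l - P 0)%:E.
  under eq_fun do rewrite E.
  apply: cvg_EFin; first exact: nearW.
  apply: cvgB.
    have := (cvg_pinftyP P l).1 Pl (fun m => m.+1%:R); apply.
    apply/cvgryPge => B; near=> m.
    apply: (@le_trans _ _ m%:R); last by rewrite ler_nat.
    by near: m; exact: nbhs_infty_ger.
  exact: (cvg_comp (fun m : nat => (m.+1%:R : R)^-1) P cvg_harmonic
    (is_derive_continuous (dP 0))).
exact: (cvg_unique _ H1 H2).
Unshelve. all: by end_near. Qed.

(** The nonnegative case applies to |f| and to |f| + f. *)
Lemma substitution (f k P : R -> R) (l L : R) :
  {in `]0, alpha[, continuous f} ->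
  (forall s, 0 < s -> f (phi s) * - phi' s = k s) -> continuous k ->
  (forall s, 0 < s -> phi' s <= 0) ->
  (forall s, 0 <= s -> oriented_integral (fun x => `|k x|) s <= L) ->
  (forall s : R, is_derive s 1 P (k s)) -> P s @[s --> +oo] --> l ->
  \int[mu]_(x in `[0, alpha]) f x = l - P 0.
Proof.
move=> cf fk ck phi'0 kL dP Pl.
pose Q := oriented_integral (fun x => `|k x|).
have ck' : continuous (fun x => `|k x|).
  by move=> x; apply: cvg_norm; exact: ck.
have dQ (s : R) : is_derive s 1 Q `|k s| by exact: is_derive_oriented_integral.
have [lQ Ql] : exists lQ : R, Q s @[s --> +oo] --> lQ.
  apply: (@ndecr_bounded_cvg _ _ 0 L) => // x z _ xz.
  by apply: is_derive_le dQ _ xz => *; exact: normr_ge0.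
have cf' : {in `]0, alpha[, continuous (fun x => `|f x|)}.
  by move=> x xa; apply: cvg_norm; exact: cf.
have fk' s : 0 < s -> `|f (phi s)| * - phi' s = `|k s|.
  move=> s0; rewrite -fk// normrM; congr (_ * _).
  by rewrite normrN ler0_norm// phi'0.
have I1 := ge0_substitution cf' (fun x => normr_ge0 _) fk' ck' dQ Ql.
have I2 : (\int[mu]_(x in `]0%R, alpha[) (`|f x| + f x)%:E =
    (lQ + l - (Q 0 + P 0))%:E)%E.
  apply: (@ge0_substitution _ (fun s => `|k s| + k s) (fun s => Q s + P s)).
  - by move=> x xa; apply: cvgD; [exact: cf'|exact: cf].
  - by move=> x; rewrite -lerBlDr sub0r ler_normr lexx orbT.
  - by move=> s s0; rewrite mulrDl fk'// fk.
  - by move=> x; apply: cvgD; [exact: ck'|exact: ck].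
  - exact: cvgD Ql Pl.
have mf : measurable_fun `]0, alpha[ f.
  apply: open_continuous_measurable_fun; first exact: interval_open.
  by move=> x; rewrite inE => xa; apply: cf.
have If : mu.-integrable `]0, alpha[ (EFin \o f).
  apply/integrableP; split; first exact/measurable_EFinP.
  by under eq_integral do rewrite /= ; rewrite I1 ltry.
have Inf : mu.-integrable `]0, alpha[ (EFin \o (fun x => `|f x|)).
  exact: integrable_norm If.
have I3 : (\int[mu]_(x in `]0%R, alpha[) (f x)%:E = (l - P 0)%:E)%E.
  have := I2; under eq_integral do rewrite EFinD.
  rewrite integralD//= I1.
  have fin : (\int[mu]_(x in `]0%R, alpha[) (f x)%:E)%E \is a fin_num.
    exact: integrable_fin_num.
  rewrite -(fineK fin) -EFinD => -[e]; congr EFin.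
  by apply: (addrI (lQ - Q 0)); rewrite e; ring.
rewrite /Rintegral.
rewrite -integral_itv_obnd_cbnd; last first.
  by apply/measurable_EFinP/measurable_fun_itv_bndo_bndcP.
rewrite -integral_itv_bndo_bndc; last exact/measurable_EFinP.
by rewrite I3.
Qed.

End Substitution.

(** * The polynomial q_n and the primitive of (t^2 - c^2)^m *)

Section Polynomials.
Context {R : realType}.

(** The primitive of (t^2 - c^2)^m that vanishes at 0, by the binomial formula. *)
Definition sq_primitive (m : nat) (c : R) : {poly R} :=
  \sum_(i < m.+1) ('C(m, i)%:R * (- c ^+ 2) ^+ (m - i) / (2 * i).+1%:R) *:
    'X^((2 * i).+1).

Lemma size_sq_primitive m c : (size (sq_primitive m c) <= (2 * m).+2)%N.
Proof.
apply: (leq_trans (size_sum _ _ _)); apply/bigmax_leqP => i _.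
rewrite (leq_trans (size_scale_leq _ _))// size_polyXn.
by have := ltn_ord i; lia.
Qed.

Lemma sq_primitive0 m c : (sq_primitive m c).[0] = 0.
Proof.
rewrite /sq_primitive horner_sum big1// => i _.
by rewrite hornerZ hornerXn expr0n /= mulr0.
Qed.

Lemma is_derive_sq_primitive m c (x : R) :
  is_derive x 1 (horner (sq_primitive m c)) ((x ^+ 2 - c ^+ 2) ^+ m).
Proof.
apply: (is_derive_eq (is_derive_poly _ _)).
rewrite [_ - _]addrC exprDn /sq_primitive raddf_sum horner_sum.
apply: eq_bigr => i _; rewrite /= derivZ derivXn hornerZ hornerMn hornerXn.
rewrite -exprM -[X in _ * X = _]mulr_natr -[RHS]mulr_natr /=.
have i0 : (2 * i).+1%:R != 0 :> R by rewrite pnatr_eq0.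
by move: ((2 * i).+1%:R) i0 => a a0; field.
Qed.

Lemma horner_catenoid_q n (x : R) : (catenoid_q n).[x] =
  \sum_(i < n) ((-1) ^+ i.+1 * 'C(n, i.+1)%:R *
     (2 * n - 1)%N%:R ^+ (2 * (n - i.+1)) * (2 * i.+1 - 1)%N%:R) *
     x ^+ (n * (2 * i.+1 - 1)).
Proof.
rewrite /catenoid_q horner_sum big_add1 big_mkord.
by apply: eq_bigr => i _; rewrite hornerZ hornerXn.
Qed.

(** The lowest term of q_n has degree n. *)
Lemma catenoid_q_bound n (alpha : R) : exists2 K : R, 0 <= K &
  forall x, 0 <= x <= alpha -> `|(catenoid_q n).[x]| <= K * x ^+ n.
Proof.
pose a (i : 'I_n) : R := (-1) ^+ i.+1 * 'C(n, i.+1)%:R *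
     (2 * n - 1)%N%:R ^+ (2 * (n - i.+1)) * (2 * i.+1 - 1)%N%:R.
exists (\sum_(i < n) `|a i| * `|alpha| ^+ (n * (2 * i))).
  by apply: sumr_ge0 => i _; rewrite mulr_ge0// exprn_ge0.
move=> x /andP[x0 xa]; rewrite horner_catenoid_q big_distrl /=.
apply: (le_trans (ler_norm_sum _ _ _)); apply: ler_sum => i _.
rewrite normrM -/(a i) (_ : (n * (2 * i.+1 - 1) = n * (2 * i) + n)%N); last by lia.
rewrite normrX (ger0_norm x0) exprD mulrA.
rewrite ler_wpM2r ?exprn_ge0// ler_wpM2l//.
by rewrite lerXn2r// ?nnegrE// (le_trans xa)// ler_norm.
Qed.

(** In the weight 2i - 1, the part 2i comes from W times the derivative of
    (B + W)^n, and the part 1 from (B + W)^n itself; the sum starts at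
    index 1, which accounts for B^n. *)
Lemma weighted_binomial n (B W : R) :
  \sum_(i < n) (B ^+ (n - i.+1) * W ^+ i.+1 * 'C(n, i.+1)%:R) * (2 * i.+1 - 1)%N%:R =
  2 * n%:R * W * (B + W) ^+ n.-1 - (B + W) ^+ n + B ^+ n.
Proof.
case: n => [|m]; first by rewrite big_ord0 !expr0 mulr0 !mul0r; ring.
have E1 : \sum_(i < m.+1) (B ^+ (m.+1 - i.+1) * W ^+ i.+1 * 'C(m.+1, i.+1)%:R) =
    (B + W) ^+ m.+1 - B ^+ m.+1.
  rewrite exprDn [in RHS]big_ord_recl /= subn0 expr0 mulr1 bin0 mulr1n [_ - _]addrC addKr.
  by apply: eq_bigr => i _; rewrite mulr_natr.
have E2 : \sum_(i < m.+1) (B ^+ (m.+1 - i.+1) * W ^+ i.+1 * 'C(m.+1, i.+1)%:R) * i.+1%:R =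
    m.+1%:R * W * (B + W) ^+ m.
  rewrite exprDn big_distrr /=; apply: eq_bigr => i _.
  rewrite subSS -(mulr_natr (B ^+ (m - i) * W ^+ i)) exprS -!mulrA -natrM.
  rewrite [('C(_, _) * _)%N]mulnC -mul_bin_diag natrM.
  by move: ('C(_, _)%:R : R) => b /=; ring.
rewrite (eq_bigr (fun i : 'I_m.+1 =>
   2 * ((B ^+ (m.+1 - i.+1) * W ^+ i.+1 * 'C(m.+1, i.+1)%:R) * i.+1%:R) -
   B ^+ (m.+1 - i.+1) * W ^+ i.+1 * 'C(m.+1, i.+1)%:R)) => [|i _]; last first.
  by rewrite natrB// natrM; ring.
by rewrite sumrB -big_distrr /= E1 E2; ring.
Qed.

(** After multiplication by y^(2n), q_n(y^2) is the weighted binomial sum for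
    B = M^2 and W = - y^(4n), and 2n = M + 1 collects the powers of B + W. *)
Lemma catenoid_q_identity n (y : R) : (0 < n)%N ->
  let M := (2 * n - 1)%N%:R in
  y ^+ (2 * n) * (catenoid_q n).[y ^+ 2] =
  M ^+ (2 * n) - (M ^+ 2 - y ^+ (4 * n)) ^+ n.-1 * (M ^+ 2 + M * y ^+ (4 * n)).
Proof.
move=> n0 /=; set M : R := (2 * n - 1)%N%:R.
transitivity (\sum_(i < n) ((M ^+ 2) ^+ (n - i.+1) * (- y ^+ (4 * n)) ^+ i.+1 *
    'C(n, i.+1)%:R) * (2 * i.+1 - 1)%N%:R).
  rewrite horner_catenoid_q big_distrr /=; apply: eq_bigr => i _.
  rewrite -/M [M ^+ (2 * _)]exprM [(- y ^+ _) ^+ _]exprNn -[(y ^+ (4 * n)) ^+ _]exprM.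
  have -> : y ^+ (4 * n * i.+1) = y ^+ (2 * n) * (y ^+ 2) ^+ (n * (2 * i.+1 - 1)).
    by rewrite -exprM -exprD; congr (_ ^+ _); lia.
  by ring.
rewrite weighted_binomial [M ^+ (2 * n)]exprM.
have -> : (M ^+ 2 - y ^+ (4 * n)) ^+ n =
    (M ^+ 2 - y ^+ (4 * n)) * (M ^+ 2 - y ^+ (4 * n)) ^+ n.-1.
  by rewrite -exprS prednK.
have -> : n%:R = (M + 1) / 2 :> R by rewrite /M natrB ?natrM; [field|lia].
by field.
Qed.

End Polynomials.
Lemma oriented_integral0 (R : realType) (f : R -> R) : oriented_integral f 0 = 0.
Proof. by rewrite /oriented_integral subrr. Qed.

(** An absolutely convergent improper integral converges, so the limit that
    [substitution] presupposes exists. *)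
Lemma cvg_substitution (R : realType) (phi phi' f k : R -> R) (alpha L : R) :
  (forall s : R, is_derive s 1 phi (phi' s)) -> continuous phi' ->
  (forall s t, 0 <= s -> s < t -> phi t < phi s) -> phi 0 = alpha ->
  (forall s, 0 < phi s) -> phi s @[s --> +oo] --> 0 ->
  {in `]0, alpha[, continuous f} ->
  (forall s, 0 < s -> f (phi s) * - phi' s = k s) -> continuous k ->
  (forall s, 0 < s -> phi' s <= 0) ->
  (forall s, 0 <= s -> oriented_integral (fun x => `|k x|) s <= L) ->
  oriented_integral k s @[s --> +oo] -->
    \int[lebesgue_measure]_(x in `[0, alpha]) f x.
Proof.
move=> dphi cphi' phi_decr phi0 phi_gt0 phi_cvg cf fk ck phi'0 kL.
pose P := oriented_integral k; pose N := oriented_integral (fun x => `|k x|).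
have ck' : continuous (fun x => `|k x|).
  by move=> x; apply: cvg_norm; exact: ck.
have dP (s : R) : is_derive s 1 P (k s) by exact: is_derive_oriented_integral.
have dN (s : R) : is_derive s 1 N `|k s| by exact: is_derive_oriented_integral.
have dS (s : R) : is_derive s 1 (fun s => P s + N s) (k s + `|k s|).
  exact: is_deriveD_fun (dP s) (dN s).
have dB (s : R) : is_derive s 1 (fun s => N s - P s) (`|k s| - k s).
  exact: is_deriveB_fun (dN s) (dP s).
have PN s : 0 <= s -> P s <= N s.
  move=> s0; rewrite -subr_ge0; have := is_derive_le dB _ s0.
  rewrite /N /P !oriented_integral0 subr0; apply=> x _.
  by rewrite subr_ge0 ler_norm.
have [l1 Nl] : exists l : R, N s @[s --> +oo] --> l.
  apply: (@ndecr_bounded_cvg _ _ 0 L) => // x z _ xz.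
  by apply: is_derive_le dN _ xz => *; exact: normr_ge0.
have [l2 Sl] : exists l : R, P s + N s @[s --> +oo] --> l.
  apply: (@ndecr_bounded_cvg _ _ 0 (L + L)) => [x z _ xz|x x0].
    apply: is_derive_le dS _ xz => t _.
    by rewrite -lerBlDr sub0r lerNl ler_normr lexx orbT.
  by rewrite lerD ?kL// (le_trans (PN _ x0))// kL.
have Pl : P s @[s --> +oo] --> l2 - l1.
  have : P s + N s - N s @[s --> +oo] --> l2 - l1 by exact: cvgB.
  by under eq_fun do rewrite addrK.
rewrite (substitution dphi cphi' phi_decr phi0 phi_gt0 phi_cvg cf fk ck phi'0 kL dP Pl).
by rewrite /P oriented_integral0 subr0.
Qed.

(** * The renormalized area of half a catenoid *)

Section HalfCatenoid.
Context {R : realType}.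
Local Notation mu := (@lebesgue_measure R).
Variables (n : nat) (c : R) (y T v : R -> R).
Hypothesis n1 : (1 <= n)%N.
Hypothesis c0 : 0 < c.
Hypothesis sys : catenoid_system n c y T v.

Let M : R := (2 * n - 1)%N%:R.
Let M0 : 0 < M. Proof. by rewrite ltr0n; lia. Qed.
Let y_gt0 := sys_y_gt0 sys.
Let y_neq0 s : y s != 0. Proof. by rewrite gt_eqF. Qed.
Let y_ge0 s : 0 <= y s. Proof. exact: ltW. Qed.
Let dy := sys_dy sys.
Let dT := sys_dT sys.
Let yT := sys_yT sys.
Let dv := sys_dv sys.
Let D s := c ^+ 2 * y s ^+ 2 + M ^+ 2.
Let D_gt0 s : 0 < D s.
Proof. by rewrite ltr_wpDl ?exprn_gt0// mulr_ge0// sqr_ge0. Qed.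
Let z := sys_z n c y v.

Let q (x : R) := (catenoid_q n).[x].
Let k s := 2 / M * (y s * q (y s ^+ 2)).

(** This identity is the origin of q_n. As T^2 - c^2 is (M^2 - y^(4n)) / y^2 and
    T' is (M + y^(4n)) / y, the last summand is the derivative of a polynomial
    in T, and the first one is what is left. *)
Lemma sys_radius_density s : (M / (c * y s)) ^+ (2 * n - 1) =
  c^-1 ^+ (2 * n - 1) * (k s / 2 +
    (T s ^+ 2 - c ^+ 2) ^+ n.-1 * ((M + y s ^+ (4 * n)) / y s)).
Proof.
have MN0 : M != 0 by rewrite gt_eqF.
have -> : M / (c * y s) = c^-1 * (M / y s) by field; rewrite y_neq0 gt_eqF.
rewrite exprMn; congr (_ * _).
have eT : T s ^+ 2 - c ^+ 2 = (M ^+ 2 - y s ^+ (4 * n)) / y s ^+ 2.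
  apply: (mulfI (expf_neq0 2 (y_neq0 s))).
  by rewrite [RHS]mulrC divfK ?expf_neq0// mulrBr yT -/M; ring.
rewrite eT [((_ - _) / _) ^+ _]expr_div_n.
have Y1 : M * y s ^+ (2 * n - 1) != 0 by rewrite mulf_neq0// expf_neq0.
apply: (mulfI Y1).
have e1 : y s ^+ (2 * n - 1) = (y s ^+ 2) ^+ n.-1 * y s.
  by rewrite -exprM -exprSr; congr (_ ^+ _); lia.
have e2 : y s ^+ (2 * n - 1) * y s = y s ^+ (2 * n).
  by rewrite -exprSr; congr (_ ^+ _); lia.
transitivity (M ^+ (2 * n)).
  rewrite expr_div_n -mulrA [X in M * X]mulrC divfK ?expf_neq0// -exprS.
  by congr (_ ^+ _); lia.
have := catenoid_q_identity (y s) n1; rewrite /= -/M -/(q _) => /eqP.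
rewrite eq_sym subr_eq => /eqP ->.
rewrite [RHS]mulrDr; congr (_ + _).
  rewrite -e2 /k; field; exact: MN0.
have : (y s ^+ 2) ^+ n.-1 != 0 by rewrite !expf_neq0.
rewrite e1; move: ((y s ^+ 2) ^+ n.-1) => Y2 Y20.
by field; rewrite y_neq0 Y20.
Qed.

Let ck : continuous k.
Proof.
move=> s; have cy : {for s, continuous y} by exact: is_derive_continuous (dy s).
have cq : {for s, continuous (fun s => q (y s ^+ 2))}.
  apply: (@continuous_comp _ _ _ (fun s => y s ^+ 2) q).
    exact: continuous_atX cy.
  exact: continuous_horner.
have H : {for s, continuous (fun s => 2 / M * (y s * q (y s ^+ 2)))}.
  apply: continuous_atM; first exact: cst_continuous.
  exact: continuous_atM cy cq.
exact: H.
Qed.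

Let alpha := y 0 ^+ 2.
Let f (x : R) := q x / Num.sqrt (x * (catenoid_Q n c).[x]).

Let QE s : (catenoid_Q n c).[y s ^+ 2] = y s ^+ 2 * T s ^+ 2.
Proof.
rewrite catenoid_QE yT -exprM (_ : (2 * (2 * n) = 4 * n)%N); last by lia.
by rewrite -/M; ring.
Qed.

Let phi' s := - (2 / M) * (y s ^+ 3 * T s).

Let dphi (s : R) : is_derive s 1 (fun s => y s ^+ 2) (phi' s).
Proof.
derive_eq; first by der.
by rewrite /phi' /= -/M; field; rewrite gt_eqF.
Qed.

(** The integrand k is O(y^(2n+1)), which is the size of v', and v is bounded. *)
Let k_bound : exists L : R, forall s, 0 <= s ->
  oriented_integral (fun x => `|k x|) s <= L.
Proof.
have [Kq Kq0 hK] := @catenoid_q_bound R n alpha.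
have [l [_ lv _]] := sys_v_limit n1 c0 sys.
pose K := 2 / M * Kq * (D 0 / c).
have K0 : 0 <= K by rewrite !mulr_ge0 ?invr_ge0 ?(ltW (D_gt0 _)) ?(ltW c0) ?(ltW M0).
exists (- K * l) => s s0.
have ck' : continuous (fun x => `|k x|).
  by move=> x; apply: cvg_norm; exact: ck.
pose N := oriented_integral (fun x => `|k x|).
have dN (r : R) : is_derive r 1 N `|k r| by exact: is_derive_oriented_integral.
have dB (x : R) : is_derive x 1 (fun s => - K * v s - N s)
    (K * (c * y x ^+ (2 * n).+1 / D x) - `|k x|).
  by derive_eq; [der|rewrite mulrN mulNr opprK].
have : 0 <= - K * v s - N s.
  have := is_derive_le dB _ s0.
  rewrite (sys_v0 sys) /N oriented_integral0 mulr0 subr0; apply => x /andP[/ltW x0 _].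
  rewrite subr_ge0 /k normrM ger0_norm ?divr_ge0 ?(ltW M0)//.
  rewrite normrM ger0_norm//.
  have yx : y x <= y 0 by exact: (sys_y_le n1 c0 sys).
  have hq : `|q (y x ^+ 2)| <= Kq * (y x ^+ 2) ^+ n.
    by apply: hK; rewrite sqr_ge0 ler_pXn2r ?nnegrE.
  apply: (@le_trans _ _ (2 / M * (y x * (Kq * (y x ^+ 2) ^+ n)))).
    by rewrite ler_wpM2l ?divr_ge0 ?(ltW M0)// ler_wpM2l.
  have DD : D x <= D 0 by rewrite lerD2r ler_wpM2l ?sqr_ge0// ler_pXn2r ?nnegrE.
  have -> : K * (c * y x ^+ (2 * n).+1 / D x) =
     (2 / M * (y x * (Kq * (y x ^+ 2) ^+ n))) * (D 0 / D x).
    rewrite /K exprS exprM; field.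
    by rewrite !gt_eqF.
  rewrite ler_peMr ?ler_pdivlMr ?mul1r//.
  by rewrite !mulr_ge0 ?invr_ge0 ?exprn_ge0 ?(ltW M0)//.
rewrite subr_ge0 => /le_trans; apply.
by rewrite !mulNr lerN2 ler_wpM2l.
Qed.

Lemma sys_cvg_integral : oriented_integral k s @[s --> +oo] -->
  \int[mu]_(x in `[0, alpha]) f x.
Proof.
have [L kL] := k_bound.
have phi_decr s t : 0 <= s -> s < t -> y t ^+ 2 < y s ^+ 2.
  by move=> s0 st; rewrite ltr_pXn2r ?nnegrE// (sys_y_lt n1 c0 sys).
have phi_gt0 s : 0 < y s ^+ 2 by rewrite exprn_gt0.
have phi_cvg : y s ^+ 2 @[s --> +oo] --> 0 by exact: (cvg_sys_y n1 c0 sys).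
apply: (cvg_substitution dphi _ phi_decr erefl phi_gt0 phi_cvg _ _ ck _ kL).
- move=> s; rewrite /phi'; suff [d /is_derive_continuous//] :
    exists d, is_derive s 1 (fun s => - (2 / M) * (y s ^+ 3 * T s)) d.
  by eexists; der.
- move=> x; rewrite in_itv/= => xa.
  have [s s0 <-] := phi_surj dphi erefl phi_cvg xa.
  have Qc : continuous (horner (catenoid_Q n c)) by exact: continuous_horner.
  have qc : continuous (horner (catenoid_q n : {poly R})) by exact: continuous_horner.
  apply: continuous_atM; first exact: qc.
  apply: cvgV.
    by rewrite gt_eqF// sqrtr_gt0 QE !mulr_gt0 ?exprn_gt0// (sys_T_gt0 n1 c0 sys).
  apply: continuous_cvg; first exact: sqrt_continuous.
  by apply: cvgM; [exact: cvg_id|exact: Qc].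
- move=> s s0; have T0 := sys_T_gt0 n1 c0 sys s0.
  rewrite /f QE (_ : y s ^+ 2 * (y s ^+ 2 * T s ^+ 2) = (y s ^+ 2 * T s) ^+ 2); last by ring.
  rewrite sqrtr_sqr ger0_norm ?mulr_ge0 ?exprn_ge0 ?(ltW T0)// /phi' /k.
  by field; rewrite y_neq0 !gt_eqF.
- move=> s s0; rewrite /phi' mulNr oppr_le0 mulr_ge0 ?divr_ge0 ?(ltW M0)//.
  by rewrite mulr_ge0 ?exprn_ge0// ltW// (sys_T_gt0 n1 c0 sys).
Qed.

(** The integral of (M / (c y))^(2n-1) from 0 to s, in closed form up to the
    convergent integral of k. *)
Definition sys_area (s : R) : R := c^-1 ^+ (2 * n - 1) *
  (oriented_integral k s / 2 + (sq_primitive n.-1 c).[T s]).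

Lemma sys_area0 : sys_area 0 = 0.
Proof.
by rewrite /sys_area oriented_integral0 (sys_T0 sys) sq_primitive0 mul0r addr0 mulr0.
Qed.

Lemma is_derive_sys_area (s : R) :
  is_derive s 1 sys_area ((M / (c * y s)) ^+ (2 * n - 1)).
Proof.
have dP := is_derive_oriented_integral s ck.
have dH := is_derive_comp_fun (is_derive_sq_primitive n.-1 c (T s)) (dT s).
derive_eq; first by rewrite /sys_area; der.
by rewrite sys_radius_density /= mulr0 addr0.
Qed.

Lemma sys_area_expansion : exists2 p : {poly R}, p.[0] = 0 &
  sys_area s - p.[z s] @[s --> +oo] -->
    c^-1 ^+ (2 * n - 1) * ((\int[mu]_(x in `[0, alpha]) f x) / 2).
Proof.
have [C C0 hC] := sys_cosh_limit n1 c0 sys.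
exists (c^-1 ^+ (2 * n - 1) *: (sq_primitive n.-1 c \Po ((c / C) *: 'X))).
  by rewrite hornerZ horner_comp hornerZ hornerX mulr0 sq_primitive0 mulr0.
have H := sys_poly_T_z n1 c0 sys C0 hC (p := sq_primitive n.-1 c) _.
have {}H : (sq_primitive n.-1 c).[T s] - (sq_primitive n.-1 c).[c / C * z s] @[s --> +oo] --> 0.
  by apply: H; apply: (leq_trans (size_sq_primitive _ _)); lia.
have : c^-1 ^+ (2 * n - 1) * (oriented_integral k s / 2 +
    ((sq_primitive n.-1 c).[T s] - (sq_primitive n.-1 c).[c / C * z s])) @[s --> +oo] -->
    c^-1 ^+ (2 * n - 1) * ((\int[mu]_(x in `[0, alpha]) f x) / 2 + 0).
  apply: cvgM; first exact: cvg_cst.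
  apply: cvgD => //; apply: cvgM; last exact: cvg_cst.
  exact: sys_cvg_integral.
rewrite addr0; apply: cvg_trans; apply: near_eq_cvg; near=> s.
rewrite /sys_area hornerZ horner_comp hornerZ hornerX; ring.
Unshelve. all: by end_near. Qed.

Let b s := (c * y s)^-1 * Num.sqrt (D s).

Let b_sqr s : b s ^+ 2 = 1 + M ^+ 2 / (c ^+ 2 * y s ^+ 2).
Proof.
rewrite /b exprMn sqr_sqrtr ?(ltW (D_gt0 _))// /D.
by field; rewrite y_neq0 gt_eqF.
Qed.

Let b_gt0 s : 0 < b s.
Proof. by rewrite mulr_gt0 ?invr_gt0 ?mulr_gt0 ?sqrtr_gt0. Qed.

Let zE s : z s = b s * cosh (v s).
Proof. by rewrite /z /sys_z mulrA. Qed.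

Lemma sys_z_gt0 s : 0 < z s.
Proof. by rewrite zE mulr_gt0 ?b_gt0 ?cosh_gt0. Qed.

Let cosh_v_le s t : 0 <= s -> s <= t -> cosh (v s) <= cosh (v t).
Proof.
move=> s0 st; have vts := sys_v_le n1 c0 sys st.
have vs0 : v s <= 0 by rewrite -(sys_v0 sys); exact: (sys_v_le n1 c0 sys).
rewrite -lerN2.
have d (r : R) : is_derive r 1 (fun x => - cosh x) (- sinh r).
  by have dc := @is_derive_cosh R; der.
apply: is_derive_le d _ vts => r /andP[_ rv].
by rewrite oppr_ge0 sinh_le0// ltW// (lt_le_trans rv).
Qed.

(** Both factors of z = b cosh v increase: b^2 = 1 + (M / (c y))^2 because y
    decreases, and cosh v because v decreases from 0. *)
Lemma sys_z_lt s t : 0 <= s -> s < t -> z s < z t.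
Proof.
move=> s0 st; rewrite !zE.
have bst : b s < b t.
  rewrite -(ltr_pXn2r (n := 2)) ?nnegrE ?(ltW (b_gt0 _))// !b_sqr ltrD2l.
  rewrite ltr_pM2l ?exprn_gt0// ltf_pV2 ?posrE ?mulr_gt0 ?exprn_gt0//.
  by rewrite ltr_pM2l ?exprn_gt0// ltr_pXn2r ?nnegrE// (sys_y_lt n1 c0 sys).
apply: (@lt_le_trans _ _ (b t * cosh (v s))).
  by rewrite ltr_pM2r// cosh_gt0.
by rewrite ler_pM2l//; apply: cosh_v_le => //; exact: ltW.
Qed.

Lemma sys_z_cvgy : z s @[s --> +oo] --> +oo.
Proof.
apply: (@ger_cvgy _ _ _ _ (fun s => (c / M * y s)^-1)).
  near=> s; rewrite zE.
  have s0 : 0 <= s by near: s; exact: nbhs_pinfty_ge.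
  have h1 : 1 <= cosh (v s).
    have <- : cosh (v 0) = 1 by rewrite (sys_v0 sys) /cosh oppr0 expR0; field.
    exact: cosh_v_le.
  apply: (@le_trans _ _ (b s)); last by rewrite ler_peMr ?(ltW (b_gt0 _)).
  rewrite -(ler_pXn2r (n := 2)) ?nnegrE ?(ltW (b_gt0 _))// ?invr_ge0 ?mulr_ge0 ?invr_ge0 ?(ltW c0) ?(ltW M0)//.
  rewrite b_sqr (_ : (c / M * y s)^-1 ^+ 2 = M ^+ 2 / (c ^+ 2 * y s ^+ 2)) ?lerDr//.
  by field; rewrite y_neq0 !gt_eqF.
apply/cvgrVy; first by apply: nearW => s; rewrite !mulr_gt0 ?invr_gt0.
rewrite -(mulr0 (c / M)); apply: cvgM; first exact: cvg_cst.
exact: (sys_y_cvg0 n1 c0 sys).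
Unshelve. all: by end_near. Qed.

Lemma continuous_sys_z : continuous z.
Proof.
move=> s; have dc := @is_derive_cosh R.
suff [d /is_derive_continuous//] : exists d, is_derive s 1
    (fun s => (c * y s)^-1 * (Num.sqrt (c ^+ 2 * y s ^+ 2 + M ^+ 2) * cosh (v s))) d.
have D0 := D_gt0 s; have cy0 : c * y s != 0 by rewrite mulf_neq0// gt_eqF.
eexists; der.
  by [].
exact: D0.
Qed.

(** For small e, S e is the parameter at which z = 1/e; it tends to infinity as
    e tends to 0, so the expansion in z becomes one in 1/e. *)
Lemma sys_truncation : exists (S : R -> R) (p : {poly R}), [/\ p.[0] = 0,
  forall e, 0 < e -> e * z 0 <= 1 ->
    0 <= S e /\ forall s, 0 <= s -> (z s <= 1 / e) = (s <= S e) &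
  sys_area (S e) - p.[e^-1] @[e --> 0^'+] -->
    c^-1 ^+ (2 * n - 1) * ((\int[mu]_(x in `[0, alpha]) f x) / 2)].
Proof.
have [p p0 pl] := sys_area_expansion.
have exS e : exists s, 0 < e -> e * z 0 <= 1 -> 0 <= s /\ z s = 1 / e.
  have [e0|e0] := ltP 0 e; last by exists 0.
  have [ez|] := leP (e * z 0) 1; last by exists 0.
  have [t [h2 h3]] : exists t, 0 <= t /\ 1 / e <= z t.
    have h1 : \forall s \near +oo, 1 / e <= z s by move/cvgryPge: sys_z_cvgy; exact.
    have [t [h2 h3]] := filter_ex (filterI h1 (nbhs_pinfty_ge (num_real (0 : R)))).
    by exists t.
  have [s] : exists2 s, s \in `[0, t] & z s = 1 / e.
    apply: IVT => //; first exact: continuous_subspaceT continuous_sys_z.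
    by rewrite ge_min le_max h3 orbT andbT ler_pdivlMr// mulrC ez.
  by rewrite in_itv/= => /andP[s0 _] zs; exists s.
have [S hS] := choice exS.
have zS e : 0 < e -> e * z 0 <= 1 -> forall s, 0 <= s -> (z s <= 1 / e) = (s <= S e).
  move=> e0 ez s s0; have [S0 zSe] := hS _ e0 ez; rewrite -zSe.
  have [sS|Ss] := leP s (S e).
    move: sS; rewrite le_eqVlt => /predU1P[->|sS]; first by rewrite lexx.
    by rewrite ltW// sys_z_lt.
  by apply/negbTE; rewrite -ltNge sys_z_lt.
have near_ez (B : R) : 0 < B -> \forall e \near (0 : R)^'+, 0 < e /\ e * B <= 1.
  move=> B0; near=> e; split; first by near: e; exact: nbhs_right_gt.
  rewrite -ler_pdivlMr// ltW//; near: e; apply: nbhs_right_lt.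
  by rewrite divr_gt0.
exists S, p; split=> //.
  by move=> e e0 ez; split; [case: (hS _ e0 ez)|exact: zS].
have Sy : S e @[e --> 0^'+] --> +oo.
  apply/cvgryPge => B; near=> e.
  have [e0 ez] : 0 < e /\ e * z 0 <= 1 by near: e; exact: near_ez (sys_z_gt0 _).
  have [_ h] : 0 < e /\ e * z (Num.max B 0) <= 1 by near: e; exact: near_ez (sys_z_gt0 _).
  apply: (@le_trans _ _ (Num.max B 0)); first by rewrite le_max lexx.
  by rewrite -zS ?le_max ?lexx ?orbT// ler_pdivlMr// mulrC.
have := cvg_comp S (fun s => sys_area s - p.[z s]) Sy pl.
apply: cvg_trans; apply: near_eq_cvg; near=> e.
have [e0 ez] : 0 < e /\ e * z 0 <= 1 by near: e; exact: near_ez (sys_z_gt0 _).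
by have [_ /=] := hS _ e0 ez; rewrite div1r => ->.
Unshelve. all: by end_near. Qed.

End HalfCatenoid.

(** * The generating curve and its reflection *)

Section SystemGeometry.
Context {R : realType}.
Local Notation mu := (@lebesgue_measure R).

Lemma is_derive_mul_sinh (b v : R -> R) (s b' v' : R) :
  is_derive s 1 b b' -> is_derive s 1 v v' ->
  is_derive s 1 (fun s => b s * sinh (v s)) (b' * sinh (v s) + b s * (cosh (v s) * v')).
Proof.
move=> db dv; have ds := is_derive_comp_fun (is_derive_sinh (v s)) dv.
by apply: is_derive_eq (is_deriveM_fun db ds) _; ring.
Qed.

Lemma is_derive_mul_cosh (b v : R -> R) (s b' v' : R) :
  is_derive s 1 b b' -> is_derive s 1 v v' ->
  is_derive s 1 (fun s => b s * cosh (v s)) (b' * cosh (v s) + b s * (sinh (v s) * v')).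
Proof.
move=> db dv; have dc := is_derive_comp_fun (is_derive_cosh (v s)) dv.
by apply: is_derive_eq (is_deriveM_fun db dc) _; ring.
Qed.

Lemma profile_system (n : nat) (c alpha : R) (u : R -> R) :
  (1 <= n)%N -> 0 < c -> only_positive_root (catenoid_Q n c) alpha ->
  catenoid_profile n c alpha u ->
  catenoid_system n c (profile_y u) (profile_T n u) (catenoid_v n c u).
Proof.
move=> n1 c0 halpha hu; split.
- by move=> s; rewrite sqrtr_gt0 (profile_gt0 hu).
- exact: is_derive_profile_y hu.
- exact: is_derive_profile_T halpha hu.
- move=> s; rewrite -(profile_Q n1 c0 hu) /=.
  have -> : u s = profile_y u s ^+ 2 by rewrite sqr_sqrtr// ltW// (profile_gt0 hu).
  by rewrite -exprM (_ : (2 * (2 * n) = 4 * n)%N); [ring|lia].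
- exact: profile_T0 halpha hu.
- exact: is_derive_catenoid_v hu.
- exact: catenoid_v0.
Qed.

Lemma reflect_system (n : nat) (c : R) (y T v : R -> R) :
  catenoid_system n c y T v ->
  catenoid_system n c (fun s => y (- s)) (fun s => - T (- s)) (fun s => - v (- s)).
Proof.
move=> sys; have dy := sys_dy sys; have dT := sys_dT sys; have dv := sys_dv sys.
split.
- by move=> s; exact: sys_y_gt0 sys _.
- by move=> s; derive_eq; [der|ring].
- by move=> s; derive_eq; [der|ring].
- by move=> s; rewrite sqrrN; exact: sys_yT sys _.
- by rewrite oppr0 (sys_T0 sys) oppr0.
- by move=> s; derive_eq; [der|ring].
- by rewrite oppr0 (sys_v0 sys) oppr0.
Qed.

Variables (n : nat) (c : R) (y T v : R -> R).
Hypothesis n1 : (1 <= n)%N.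
Hypothesis c0 : 0 < c.
Hypothesis sys : catenoid_system n c y T v.

Let M : R := (2 * n - 1)%N%:R.
Let M0 : 0 < M. Proof. by rewrite ltr0n; lia. Qed.
Let y_gt0 := sys_y_gt0 sys.
Let y_neq0 s : y s != 0. Proof. by rewrite gt_eqF. Qed.
Let dy := sys_dy sys.
Let dT := sys_dT sys.
Let yT := sys_yT sys.
Let dv := sys_dv sys.

Lemma sys_z_reflect s :
  sys_z n c (fun s => y (- s)) (fun s => - v (- s)) s = sys_z n c y v (- s).
Proof. by rewrite /sys_z coshN. Qed.

(** Both sides vanish at 0 and have the same derivative. *)
Lemma sys_area_reflect s :
  sys_area n c (fun s => y (- s)) (fun s => - T (- s)) s = - sys_area n c y T (- s).
Proof.
have dA := is_derive_sys_area n1 c0 sys.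
have dA' := is_derive_sys_area n1 c0 (reflect_system sys).
pose F s := sys_area n c (fun s => y (- s)) (fun s => - T (- s)) s + sys_area n c y T (- s).
have dF (x : R) : is_derive x 1 F 0 by derive_eq; [rewrite /F; der|ring].
have := is_derive_0_is_cst s 0 dF; rewrite /F oppr0.
rewrite !(sys_area0 sys) (sys_area0 (reflect_system sys)).
by rewrite addr0 => /eqP; rewrite addr_eq0 => /eqP.
Qed.

Let D s := c ^+ 2 * y s ^+ 2 + M ^+ 2.
Let D_gt0 s : 0 < D s.
Proof. by rewrite ltr_wpDl ?exprn_gt0// mulr_ge0// sqr_ge0. Qed.

Let r s := Num.sqrt (D s).
Let r_gt0 s : 0 < r s. Proof. by rewrite sqrtr_gt0. Qed.
Let r2 s : r s ^+ 2 = D s. Proof. by rewrite sqr_sqrtr// ltW. Qed.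

Let dr (s : R) : is_derive s 1 r (- (c ^+ 2 * y s ^+ 3 * T s) / (M * r s)).
Proof.
derive_eq; first by rewrite /r /D; der; exact: D_gt0.
rewrite -/(D s) -/(r s) -/M /=.
by field; rewrite !gt_eqF.
Qed.

Let a s := M / (c * y s).
Let b s := (c * y s)^-1 * r s.
Let w' s := - (c * y s ^+ (2 * n).+1 / D s).

Let b_gt0 s : 0 < b s.
Proof. by rewrite mulr_gt0 ?invr_gt0 ?mulr_gt0. Qed.

Let b2 s : b s ^+ 2 = D s / (c ^+ 2 * y s ^+ 2).
Proof. by rewrite /b exprMn r2 exprVn exprMn mulrC. Qed.

Let da (s : R) : is_derive s 1 a (T s / c).
Proof.
have cy0 : c * y s != 0 by rewrite mulf_neq0// gt_eqF.
derive_eq; first by rewrite /a; der.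
by rewrite -/M /=; field; rewrite y_neq0 !gt_eqF.
Qed.

Let b' s := M * T s / (c * r s).

Let db (s : R) : is_derive s 1 b (b' s).
Proof.
have cy0 : c * y s != 0 by rewrite mulf_neq0// gt_eqF.
derive_eq; first by rewrite /b; der.
rewrite -/M /b'.
transitivity (T s * (r s ^+ 2 - c ^+ 2 * y s ^+ 2) / (M * c * r s)).
  by field; rewrite y_neq0 !gt_eqF.
by rewrite r2 /D; field; rewrite !gt_eqF.
Qed.

Let X s := b s * sinh (v s).
Let Y s := b s * cosh (v s).
Let X' s := b' s * sinh (v s) + b s * (cosh (v s) * w' s).
Let Y' s := b' s * cosh (v s) + b s * (sinh (v s) * w' s).

Let dX (s : R) : is_derive s 1 X (X' s).
Proof. exact: is_derive_mul_sinh. Qed.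

Let dY (s : R) : is_derive s 1 Y (Y' s).
Proof. exact: is_derive_mul_cosh. Qed.

Let ca' : continuous (fun s => T s / c).
Proof.
move=> s; suff [d /is_derive_continuous//] :
  exists d, is_derive s 1 (fun s => T s / c) d.
by eexists; der.
Qed.

Let cb' : continuous b'.
Proof.
move=> s; have cr0 : c * r s != 0 by rewrite mulf_neq0// gt_eqF.
suff [d /is_derive_continuous//] : exists d, is_derive s 1 b' d.
by eexists; rewrite /b'; der.
Qed.

Let cw' : continuous w'.
Proof.
move=> s; have D0 := lt0r_neq0 (D_gt0 s).
suff [d /is_derive_continuous//] : exists d, is_derive s 1 w' d.
by eexists; rewrite /w' /D; der.
Qed.

Let cX' : continuous X'.
Proof.
move=> s; have cs := is_derive_continuous (is_derive_comp_fun (is_derive_sinh _) (dv s)).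
have cc := is_derive_continuous (is_derive_comp_fun (is_derive_cosh _) (dv s)).
apply: cvgD; apply: cvgM => //; [exact: cb'|exact: is_derive_continuous (db s)|].
by apply: cvgM => //; exact: cw'.
Qed.

Let cY' : continuous Y'.
Proof.
move=> s; have cs := is_derive_continuous (is_derive_comp_fun (is_derive_sinh _) (dv s)).
have cc := is_derive_continuous (is_derive_comp_fun (is_derive_cosh _) (dv s)).
apply: cvgD; apply: cvgM => //; [exact: cb'|exact: is_derive_continuous (db s)|].
by apply: cvgM => //; exact: cw'.
Qed.

(** With b^2 = (c^2 y^2 + M^2) / (c y)^2 the curve is (a, b sinh v, b cosh v), and
    the square of its speed is (y^2 T^2 + y^(4n)) / (c^2 y^2 + M^2), which is 1 by
    the first integral of the system. *)
Let speed s : (T s / c) ^+ 2 + X' s ^+ 2 - Y' s ^+ 2 = 1.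
Proof.
transitivity ((T s / c) ^+ 2 + (b s ^+ 2 * w' s ^+ 2 - b' s ^+ 2) *
    (cosh (v s) ^+ 2 - sinh (v s) ^+ 2)).
  by rewrite /X' /Y'; move: (b s) (b' s) (w' s) => *; ring.
rewrite cosh2_sinh2 mulr1 b2.
have -> : b' s ^+ 2 = M ^+ 2 * T s ^+ 2 / (c ^+ 2 * D s).
  by rewrite /b' exprMn exprVn !exprMn r2.
have -> : w' s ^+ 2 = c ^+ 2 * (y s ^+ 2 * y s ^+ (4 * n)) / D s ^+ 2.
  rewrite /w' sqrrN exprMn exprVn exprMn -exprM -exprD.
  by congr (_ * _ ^+ _ / _); lia.
transitivity ((y s ^+ 2 * T s ^+ 2 + y s ^+ (4 * n)) / D s).
  have eM : M ^+ 2 = D s - c ^+ 2 * y s ^+ 2 by rewrite /D addrC addKr.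
  rewrite eM; move: (D s) (y s ^+ (4 * n)) (lt0r_neq0 (D_gt0 s)) => P W P0.
  by field; rewrite y_neq0 P0 gt_eqF.
by rewrite yT -/M subrK -/(D s) divff// gt_eqF.
Qed.

Let hyp s : a s ^+ 2 + X s ^+ 2 - Y s ^+ 2 = -1.
Proof.
transitivity (a s ^+ 2 - b s ^+ 2 * (cosh (v s) ^+ 2 - sinh (v s) ^+ 2)).
  by rewrite /X /Y; move: (a s) (b s) => *; ring.
rewrite cosh2_sinh2 mulr1 b2 /a /D.
by field; rewrite y_neq0 gt_eqF.
Qed.

Let sinh_lt (x z : R) : x < z -> sinh x < sinh z.
Proof.
by move=> xz; apply: (is_derive_lt (@is_derive_sinh R)) xz => *; exact: cosh_gt0.
Qed.

Let v_lt s t : s < t -> v t < v s.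
Proof.
move=> st; rewrite -ltrN2.
have dNv (x : R) : is_derive x 1 (fun s => - v s) (c * y x ^+ (2 * n).+1 / D x).
  by derive_eq; [der|rewrite opprK].
apply: is_derive_lt dNv _ st => x _.
by rewrite divr_gt0// mulr_gt0// exprn_gt0.
Qed.

Let curve_inj s t : a s = a t -> X s = X t -> Y s = Y t -> s = t.
Proof.
move=> ast Xst _.
have yst : y s = y t.
  move: ast => /(mulfI (lt0r_neq0 M0))/invr_inj/mulfI; apply.
  exact: lt0r_neq0.
have bst : b s = b t by rewrite /b /r /D yst.
move: Xst; rewrite /X bst => /(mulfI (lt0r_neq0 (b_gt0 t))) hv.
have [st|ts|//] := ltgtP s t.
  by have := sinh_lt (v_lt st); rewrite hv ltxx.
by have := sinh_lt (v_lt ts); rewrite hv ltxx.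
Qed.

Lemma sys_has_area (m d : nat) (J : set R) : m = d.+1 -> (0 < d)%N ->
  measurable J ->
  has_area m [set P | exists s (w : 'rV_m), [/\ J s, unit_sphere w &
      P = rot_point (a s *: w) (X s) (sys_z n c y v s)]]
    ((sphere_volume d)%:E * \int[mu]_(s in J) (a s ^+ d)%:E)%E.
Proof.
move=> -> d0 mJ.
have -> : sys_z n c y v = Y by apply/funext => s; rewrite /sys_z mulrA.
apply: (rotational_area d0 da dX dY ca' cX' cY' speed _ _ hyp curve_inj mJ).
  by move=> s; rewrite divr_gt0 ?mulr_gt0.
by move=> s; rewrite mulr_gt0 ?cosh_gt0.
Qed.

End SystemGeometry.

(** * The two halves together *)

Section Assembly.
Context {R : realType}.
Local Notation mu := (@lebesgue_measure R).

Lemma integral_is_derive (f df : R -> R) (a b : R) :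
  (forall s : R, is_derive s 1 f (df s)) -> continuous df -> a <= b ->
  (\int[mu]_(x in `[a, b]) (df x)%:E = (f b - f a)%:E)%E.
Proof.
move=> d cdf ab; rewrite -(Rintegral_is_derive d cdf ab) /Rintegral fineK//.
apply: integrable_fin_num => //; apply: continuous_compact_integrable.
  exact: segment_compact.
exact: continuous_subspaceT.
Qed.

Lemma constant_term_poly (A : R -> R) (p : {poly R}) (l : R) : p.[0] = 0 ->
  A e - p.[e^-1] @[e --> 0^'+] --> l -> constant_term A l.
Proof.
move=> p0 Al; exists (size p), (fun k => p`_k).
apply: cvg_trans Al; apply: near_eq_cvg; near=> e.
rewrite (horner_coef_wide _ (leqnSn (size p))) -(big_mkord predT (fun i => p`_i * e^-1 ^+ i)).
rewrite big_ltn// -[p`_0]horner_coef0 p0 mul0r add0r.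
by congr (_ - _); apply: eq_bigr => k _; rewrite exprVn.
Unshelve. all: by end_near. Qed.

Lemma sphere_volume_odd (n : nat) : (1 <= n)%N ->
  sphere_volume (2 * n - 1) = 2 * pi ^+ n / (n.-1)`!%:R :> R.
Proof.
case: n => // m _; rewrite /sphere_volume.
have -> : (2 * m.+1 - 1 = (2 * m).+1)%N by lia.
by rewrite /= (_ : (2 * m + (2 * m).+1 = (4 * m).+1)%N) ?sphere_volume_rec//; lia.
Qed.

(** The parameters with z <= 1/e form an interval around 0, whose ends are found
    separately on the two halves; each half contributes half of the integral. *)
Lemma sys_expansion (n : nat) (c : R) (y T v : R -> R) :
  (1 <= n)%N -> 0 < c -> catenoid_system n c y T v ->
  exists (A : R -> R) (p : {poly R}), [/\ p.[0] = 0,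
    \forall e \near 0^'+, let J := [set s | sys_z n c y v s <= 1 / e] in
      measurable J /\
      (\int[mu]_(s in J) (((2 * n - 1)%N%:R / (c * y s)) ^+ (2 * n - 1))%:E =
        (A e)%:E)%E &
    A e - p.[e^-1] @[e --> 0^'+] --> c^-1 ^+ (2 * n - 1) *
      \int[mu]_(x in `[0, y 0 ^+ 2])
        ((catenoid_q n).[x] / Num.sqrt (x * (catenoid_Q n c).[x]))].
Proof.
move=> n1 c0 sys; have sys' := reflect_system sys.
have [S1 [p1 [p10 hS1 l1]]] := sys_truncation n1 c0 sys.
have [S2 [p2 [p20 hS2]]] := sys_truncation n1 c0 sys'.
rewrite oppr0 => l2; set I := Rintegral _ _ _ in l1 l2 *.
exists (fun e => sys_area n c y T (S1 e) - sys_area n c y T (- S2 e)), (p1 + p2).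
split; first by rewrite hornerD p10 p20 addr0.
  have z0 : 0 < sys_z n c y v 0 by exact: (sys_z_gt0 n1 c0 sys).
  near=> e.
  have e0 : 0 < e by near: e; exact: nbhs_right_gt.
  have ez : e * sys_z n c y v 0 <= 1.
    rewrite -ler_pdivlMr// ltW//; near: e; apply: nbhs_right_lt.
    by rewrite divr_gt0.
  have [S1e {}hS1] := hS1 _ e0 ez.
  have [S2e {}hS2] : 0 <= S2 e /\ forall s, 0 <= s ->
      (sys_z n c y v (- s) <= 1 / e) = (s <= S2 e).
    have := hS2 _ e0; rewrite sys_z_reflect oppr0 => /(_ ez)[h1 h2].
    by split=> // s s0; rewrite -h2// sys_z_reflect.
  have -> : [set s | sys_z n c y v s <= 1 / e] = `[- S2 e, S1 e]%classic.
    apply/seteqP; split=> s /=; rewrite in_itv/=.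
      have [s0|/ltW s0] := leP 0 s.
        by rewrite hS1// => ->; rewrite (le_trans _ s0)// oppr_le0.
      rewrite -[s in sys_z _ _ _ _ s]opprK hS2 ?oppr_ge0// lerNl => ->.
      exact: le_trans S1e.
    have [s0|/ltW s0] := leP 0 s; first by rewrite hS1// => /andP[].
    by rewrite -[s in sys_z _ _ _ _ s]opprK hS2 ?oppr_ge0// lerNl => /andP[].
  split; first exact: measurable_itv.
  apply: integral_is_derive; first exact: is_derive_sys_area n1 c0 sys.
    move=> s; have dy := sys_dy sys.
    have cy0 : c * y s != 0 by rewrite mulf_neq0 ?gt_eqF// (sys_y_gt0 sys).
    suff [d /is_derive_continuous//] : exists d, is_derive s 1
      (fun s => ((2 * n - 1)%N%:R / (c * y s)) ^+ (2 * n - 1)) d.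
    by eexists; der.
  by apply: le_trans S1e; rewrite oppr_le0.
rewrite [X in _ * X]splitr mulrDr.
apply: cvg_trans (cvgD l1 l2); apply: near_eq_cvg; near=> e.
have := sys_area_reflect n1 c0 sys (S2 e); rewrite fctE /= hornerD => ->; ring.
Unshelve. all: by end_near. Qed.

(** The exponents n(2i - 1) increase with i and the coefficient of the last term
    is (2n - 1) up to sign. *)
Lemma size_catenoid_q (n : nat) : (1 <= n)%N ->
  size (catenoid_q n : {poly R}) = (n * (2 * n - 1)).+1.
Proof.
move=> n1; rewrite /catenoid_q; case: n n1 => // m _; rewrite big_nat_recr//=.
set F := fun i : nat => _; set a := _ * _.
have a0 : a != 0.
  rewrite /a subnn muln0 expr0 mulr1 binn mulr1 mulf_neq0 ?signr_eq0// pnatr_eq0.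
  by lia.
rewrite addrC size_polyDl size_scale// size_polyXn//.
apply: (leq_ltn_trans (size_sum _ _ _)); rewrite ltnS.
rewrite big_seq; apply/bigmax_leqP_seq => i; rewrite mem_index_iota => _ /andP[i1 im].
apply: (leq_trans (size_scale_leq _ _)); rewrite size_polyXn.
by nia.
Qed.

Lemma catenoid_truncation (n : nat) (c : R) (u : R -> R) (e : R) :
  let y := profile_y u in let v := catenoid_v n c u in
  (forall s, 0 < u s) ->
  truncation (catenoid n c u) e =
  [set P | exists s (w : 'rV_(2 * n)),
     [/\ sys_z n c y v s <= 1 / e, unit_sphere w &
      P = rot_point (((2 * n - 1)%N%:R / (c * y s)) *: w)
        ((c * y s)^-1 * Num.sqrt (c ^+ 2 * y s ^+ 2 +
           (2 * n - 1)%N%:R ^+ 2) * sinh (v s))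
        (sys_z n c y v s)]].
Proof.
move=> y v u_gt0; have y2 s : y s ^+ 2 = u s by rewrite sqr_sqrtr// ltW.
have pt s (w : 'rV_(2 * n)) : catenoid_point c u s w =
   rot_point (((2 * n - 1)%N%:R / (c * y s)) *: w)
        ((c * y s)^-1 * Num.sqrt (c ^+ 2 * y s ^+ 2 +
           (2 * n - 1)%N%:R ^+ 2) * sinh (v s))
        (sys_z n c y v s).
  rewrite /catenoid_point /rot_point /sys_z y2 -/(y s) !scale_row_mx !scale_scalar_mx scalerA.
  by rewrite [_^-1 * (2 * n - 1)%N%:R]mulrC mulrA.
apply/seteqP; split=> P /=.
  by move=> [[s [w [w1 ->]]]]; rewrite /= pt zcoord_rot => zs; exists s, w.
by move=> [s [w [zs w1 ->]]]; split; [exists s, w; rewrite pt|rewrite /= zcoord_rot].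
Qed.

End Assembly.

Theorem theorem6p4 (R : realType) (n : nat) (c alpha : R) (u : R -> R)
    (hn : (1 <= n)%N) (hc : 0 < c)
    (halpha : only_positive_root (catenoid_Q n c) alpha)
    (hu : catenoid_profile n c alpha u) :
  size (catenoid_q n : {poly R}) = (n * (2 * n - 1)).+1 /\
  renormalized_area (catenoid n c u)
    (2 * pi ^+ n / ((n.-1)`!%:R * c ^+ (2 * n - 1)) *
     \int[lebesgue_measure]_(x in `[0, alpha])
       ((catenoid_q n).[x] / Num.sqrt (x * (catenoid_Q n c).[x]))).
Proof.
split; first exact: size_catenoid_q.
have sys := profile_system hn hc halpha hu.
have [A [p [p0 hA hl]]] := sys_expansion hn hc sys.
pose V : R := sphere_volume (2 * n - 1).
exists (fun e => V * A e); split.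
  near=> e.
  have [mJ IJ] : let J := [set s | sys_z n c (profile_y u) (catenoid_v n c u) s <= 1 / e] in
      measurable J /\
      (\int[lebesgue_measure]_(s in J)
        (((2 * n - 1)%N%:R / (c * profile_y u s)) ^+ (2 * n - 1))%:E = (A e)%:E)%E.
    by near: e.
  rewrite EFinM -IJ catenoid_truncation; last by move=> s; exact: profile_gt0 hu s.
  have e2n : (2 * n = (2 * n - 1).+1)%N by lia.
  by apply: (sys_has_area hn hc sys e2n) => //; lia.
apply: (@constant_term_poly _ _ (V *: p)); first by rewrite hornerZ p0 mulr0.
have -> : 2 * pi ^+ n / ((n.-1)`!%:R * c ^+ (2 * n - 1)) = V * c^-1 ^+ (2 * n - 1).
  by rewrite /V sphere_volume_odd// exprVn invfM mulrA.
have y0 : profile_y u 0 ^+ 2 = alpha.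
  have u0 : u 0 = alpha by case: hu.
  by rewrite -u0 sqr_sqrtr// ltW// (profile_gt0 hu).
move: hl; rewrite y0 => hl; rewrite -mulrA.
apply: cvg_trans (cvgM (cvg_cst V) hl); apply: near_eq_cvg; near=> e.
by rewrite hornerZ -mulrBr.
Unshelve. all: by end_near. Qed.
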